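(* Let $K$ be a finite field with $|K|=q$, let $W$ be a $K$-vector space of dimension greater than one, and let $m=q+1$. Let $(\mathcal{U},\mathcal{V})$, with $\mathcal{U}=(U_1,\dots,U_m)$ and $\mathcal{V}=(V_1,\dots,V_m)$ tuples of finite-dimensional subspaces of $W$, be a nontrivial solution of the isometry equation $$\sum_{i=1}^m \frac{1}{|V_i|}\mathbb{1}_{V_i}=\sum_{i=1}^m \frac{1}{|U_i|}\mathbb{1}_{U_i}.$$ Then $(\mathcal{U},\mathcal{V})$ is equivalent (as a pair of tuples) to a pair of one of the following types: Type A, Type B or Type C.
   Context: For a subset $X\subseteq W$, $\mathbb{1}_X:W\to\{0,1\}$ is the indicator function of $X$; the isometry equation is an equality of functions on $W$. A pair of tuples $(\mathcal{U},\mathcal{V})$ is a solution if it satisfies the isometry equation. Tuples $\mathcal{U},\mathcal{V}$ of length $m$ are equivalent, $\mathcal{U}\sim\mathcal{V}$, if there is a permutation $\pi\in S_m$ with $V_i=U_{\pi(i)}$ for all $i\in\{1,\dots,m\}$. A solution $(\mathcal{U},\mathcal{V})$ is trivial if $\mathcal{U}\sim\mathcal{V}$, and nontrivial otherwise. Pairs $(\mathcal{U},\mathcal{V})$ and $(\mathcal{U}',\mathcal{V}')$ are equivalent if either $\mathcal{U}\sim\mathcal{U}'$ and $\mathcal{V}\sim\mathcal{V}'$, or $\mathcal{V}\sim\mathcal{U}'$ and $\mathcal{U}\sim\mathcal{V}'$. Write $\langle\,\cdot\,\rangle_K$ for the $K$-linear span (so $\langle S,a,b\rangle_K$ is the span of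 the subspace $S$ and the vectors $a,b$). Fix enumerations $[\alpha_i:\beta_i]$, $i\in\{1,\dots,q+1\}$, of the points of the projective line $\mathbb{P}_1(K)$ (for Types A and C), and an enumeration $\alpha_1,\dots,\alpha_q$ of the elements of $K$ (for Type B). Here $m=q+1$. Type A: there exist a subspace $S\subseteq W$ and linearly independent vectors $a,b\in W$ with $S\cap\langle a,b\rangle_K=\{0\}$ such that $V_1=\dots=V_q=\langle S,a,b\rangle_K$, $V_{q+1}=S$, and $U_i=\langle S,\alpha_i a+\beta_i b\rangle_K$ for $i\in\{1,\dots,q+1\}$. Type B: there exist a subspace $S\subseteq W$ and linearly independent vectors $a,b,c\in W$ with $S\cap\langle a,b,c\rangle_K=\{0\}$ such that $V_m=\langle S,a\rangle_K$, $U_m=\langle S,b\rangle_K$, and $V_i=\langle S,b,\alpha_i a+c\rangle_K$, $U_i=\langle S,a,\alpha_i b+c\rangle_K$ for $i\in\{1,\dots,q\}$. Type C: there exist a subspace $S\subseteq W$ and linearly independent vectors $a,b,c,d\in W$ with $S\cap\langle a,b,c,d\rangle_K=\{0\}$ such that $V_i=\langle S,\alpha_i a+\beta_i b,\alpha_i c+\beta_i d\rangle_K$ and $U_i=\langle S,\alpha_i a+\beta_i c,\alpha_i b+\beta_i d\rangle_K$ for $i\in\{1,\dots,m\}$. *)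

(* Defs.v *)
From HB Require Import structures.
From mathcomp Require Import all_boot all_order all_fingroup all_algebra.
From mathcomp Require Import finmap all_classical numfun.
Set Implicit Arguments.
Unset Strict Implicit.
Unset Printing Implicit Defensive.
Import Order.TTheory GRing.Theory Num.Theory.
Local Open Scope classical_set_scope.
Local Open Scope ring_scope.

Definition is_subspace (K : fieldType) (W : lmodType K) (A : set W) : Prop :=
  submod_closed (mem A).

Definition lspan (K : fieldType) (W : lmodType K) (X : set W) : set W :=
  smallest (@is_subspace K W) X.

Definition fin_dim (K : fieldType) (W : lmodType K) (A : set W) : Prop :=
  exists X : set W, finite_set X /\ A = lspan X.

Definition lin_indep (K : fieldType) (W : lmodType K) (s : seq W) : Prop :=
  forall c : 'I_(size s) -> K,
    \sum_(i < size s) c i *: s`_i = 0 -> forall i, c i = 0.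

(* W may be infinite-dimensional. *)
Definition dim_gt (K : fieldType) (W : lmodType K) (n : nat) : Prop :=
  exists s : seq W, size s = n.+1 /\ lin_indep s.

(* [fset_set] sends an infinite set to the empty one, so this is the cardinality
   only of finite sets; finite-dimensional spaces over a finite field are finite. *)
Definition card_set (T : choiceType) (A : set T) : nat := #|` fset_set A|%fset.

Definition isometry_eq (K : fieldType) (W : lmodType K) (m : nat)
    (U V : 'I_m -> set W) : Prop :=
  (fun w : W => \sum_(i < m) (card_set (V i))%:R^-1 * \1_(V i) w : rat) =
  (fun w : W => \sum_(i < m) (card_set (U i))%:R^-1 * \1_(U i) w : rat).

Definition tuple_equiv (T : Type) (m : nat) (U V : 'I_m -> T) : Prop :=
  exists p : 'S_m, forall i, V i = U (p i).

Definition pair_equiv (T : Type) (m : nat) (U V U' V' : 'I_m -> T) : Prop :=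
  (tuple_equiv U U' /\ tuple_equiv V V') \/
  (tuple_equiv V U' /\ tuple_equiv U V').

(* [alpha i : beta i] are homogeneous coordinates, with an arbitrary choice of
   representatives, and every point of P_1(K) occurs for exactly one i. *)
Definition P1_enum (K : fieldType) (n : nat) (alpha beta : 'I_n -> K) : Prop :=
  (forall i, (alpha i, beta i) != (0, 0)) /\
  (forall x y : K, (x, y) != (0, 0) ->
     exists! i : 'I_n, exists l : K,
       l != 0 /\ x = l * alpha i /\ y = l * beta i).

Definition init_ord (q : nat) (i : 'I_q) : 'I_q.+1 := widen_ord (leqnSn q) i.

Section Types.
Variables (K : fieldType) (W : lmodType K) (q : nat).

Definition typeA (alpha beta : 'I_q.+1 -> K) (U V : 'I_q.+1 -> set W) : Prop :=
  exists (S : set W) (a b : W),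
    [/\ is_subspace S, lin_indep [:: a; b],
        S `&` lspan [set a; b] = [set 0] &
        [/\ forall i : 'I_q, V (init_ord i) = lspan (S `|` [set a; b]),
            V ord_max = S &
            forall i : 'I_q.+1,
              U i = lspan (S `|` [set alpha i *: a + beta i *: b])]].

Definition typeB (gamma : 'I_q -> K) (U V : 'I_q.+1 -> set W) : Prop :=
  exists (S : set W) (a b c : W),
    [/\ is_subspace S, lin_indep [:: a; b; c],
        S `&` lspan [set a; b; c] = [set 0] &
        [/\ V ord_max = lspan (S `|` [set a]),
            U ord_max = lspan (S `|` [set b]),
            forall i : 'I_q,
              V (init_ord i) = lspan (S `|` [set b; gamma i *: a + c]) &
            forall i : 'I_q,
              U (init_ord i) = lspan (S `|` [set a; gamma i *: b + c])]].

Definition typeC (alpha beta : 'I_q.+1 -> K) (U V : 'I_q.+1 -> set W) : Prop :=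
  exists (S : set W) (a b c d : W),
    [/\ is_subspace S, lin_indep [:: a; b; c; d],
        S `&` lspan [set a; b; c; d] = [set 0] &
        forall i : 'I_q.+1,
          V i = lspan (S `|` [set alpha i *: a + beta i *: b;
                                  alpha i *: c + beta i *: d]) /\
          U i = lspan (S `|` [set alpha i *: a + beta i *: c;
                                  alpha i *: b + beta i *: d])].

End Types.

(* Main.v *)
Require Import Defs.
From HB Require Import structures.
From mathcomp Require Import all_boot all_order all_fingroup all_algebra.
From mathcomp Require Import finmap all_classical numfun.
From mathcomp Require Import finfield zify.
Set Implicit Arguments.
Unset Strict Implicit.
Unset Printing Implicit Defensive.
Import Order.TTheory GRing.Theory Num.Theory.
Local Open Scope classical_set_scope.
Local Open Scope ring_scope.

(* Let [q = #|K|].  A space [X] of dimension [n] covered by [q + 1] proper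
   subspaces is covered by the [q + 1] hyperplanes through a subspace of
   codimension 2, each occurring once.  In a nontrivial solution, a subspace [X]
   of maximal dimension among those occurring more often in one tuple than in
   the other is covered by members of the other tuple, so all [q + 1] of them are
   needed; hence the two tuples have no common member, and every member of the
   maximal dimension [n] is met by the members of the other tuple in such a
   pencil of hyperplanes.  Say [V_i0] has dimension [n].
   - If no [U_j] has dimension [n], the [U_j] form the pencil, and evaluating the
     equation on [V_i0] yields Type A.
   - If some [U_j] and some but not all [V_i] have dimension [n], then exactly one
     member of each tuple has dimension [n - 1], which yields Type B.
   - If all members have dimension [n], summing the equation over [U_j] shows that
     the [U_i] meet pairwise in a common subspace [S] of dimension [n - 2], which is
     also the pairwise intersection of the [V_i].  Modulo [S] the two tuples are
     the two rulings of a regulus, which is Type C. *)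

(** * Subspaces modulo a subspace *)

Section LinearAlgebra.
Variables (K : fieldType) (vT : vectType K).
Implicit Types (S T : {vspace vT}) (u v w : vT).

Lemma memv_add_lineP S u w :
  reflect (exists x, w - x *: u \in S) (w \in S + <[u]>)%VS.
Proof.
apply: (iffP memv_addP) => [[s sS [l /vlineP[x ->] ->]]|[x wS]].
  by exists x; rewrite addrK.
by exists (w - x *: u) => //; exists (x *: u); [rewrite memvZ ?memv_line|rewrite subrK].
Qed.

Lemma memv_add_line2P S u v w :
  reflect (exists x y, w - x *: u - y *: v \in S) (w \in S + <[u]> + <[v]>)%VS.
Proof.
apply: (iffP (memv_add_lineP _ _ _)).
  by move=> [y /memv_add_lineP[x h]]; exists x, y; rewrite addrAC.
by move=> [x [y h]]; exists y; apply/memv_add_lineP; exists x; rewrite addrAC.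
Qed.

Lemma subv_add_line S T u : (S + <[u]> <= T)%VS = (S <= T)%VS && (u \in T).
Proof. by rewrite subv_add. Qed.

Lemma dimv_add_line S u : u \notin S -> \dim (S + <[u]>) = (\dim S).+1.
Proof.
move=> uS; rewrite dimv_disjoint_sum.
  by rewrite dim_vline; case: eqP uS => [->|_ _]; rewrite ?mem0v ?addn1.
apply/eqP; rewrite -subv0; apply/subvP => w /memv_capP[wS /vlineP[x wx]].
move: wS; rewrite wx; case: (eqVneq x 0) => [->|x0]; first by rewrite scale0r !mem0v.
by rewrite rpredZeq (negPf x0) (negPf uS).
Qed.

Lemma dimv_lt_notin S T : (\dim S < \dim T)%N -> exists2 u, u \in T & u \notin S.
Proof.
by move=> dST; apply/subvPn; apply: contraTN dST => /dimvS; rewrite -leqNgt.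
Qed.

Lemma subv_dim_eq S T : (S <= T)%VS -> \dim T = \dim S -> S = T.
Proof. by move=> ST dT; apply/eqP; rewrite eqEdim ST dT /=. Qed.

Lemma eq_add_line S T u : (S <= T)%VS -> u \in T -> u \notin S ->
  \dim T = (\dim S).+1 -> T = (S + <[u]>)%VS.
Proof.
move=> ST uT uS dT; apply/esym/subv_dim_eq; first by rewrite subv_add_line ST.
by rewrite dimv_add_line.
Qed.

Lemma eq_add_line2 S T u v : (S <= T)%VS -> u \in T -> v \in T ->
  u \notin S -> v \notin (S + <[u]>)%VS ->
  \dim T = (\dim S).+2 -> T = (S + <[u]> + <[v]>)%VS.
Proof.
move=> ST uT vT' uS vS dT; apply: eq_add_line => //.
  by rewrite subv_add_line ST.
by rewrite dimv_add_line.
Qed.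

Lemma dimv_codim1_line S T : (S <= T)%VS -> \dim T = (\dim S).+1 ->
  exists2 u, u \notin S & T = (S + <[u]>)%VS.
Proof.
move=> ST dT; have [|u uT uS] := @dimv_lt_notin S T; first by rewrite dT.
by exists u => //; apply: eq_add_line.
Qed.

(** Independence modulo [S]; it yields both the independence and the trivial intersection with [S]
    that each type asks for. Indexing the coefficients by [nat] makes it easy to shift them in
    [free_mod_cons]. *)
Definition free_mod S (s : seq vT) := forall c : nat -> K,
  \sum_(i < size s) c i *: s`_i \in S -> forall i, (i < size s)%N -> c i = 0.

Lemma free_mod0 S : free_mod S [::].
Proof. by []. Qed.

Lemma free_mod_cons S u s :
  u \notin S -> free_mod (S + <[u]>) s -> free_mod S (u :: s).
Proof.
move=> uS frs c; rewrite /= big_ord_recl /= => cS.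
have c0 i : (i < size s)%N -> c i.+1 = 0.
  move=> lti; apply: (frs (fun i => c i.+1)) => //.
  apply/memv_add_lineP; exists (- c 0%N).
  by rewrite scaleNr opprK addrC.
move=> [_|i]; last exact: c0.
move: cS; rewrite big1 => [|i _]; last by rewrite c0 ?scale0r.
by rewrite addr0 rpredZeq (negPf uS) orbF => /eqP.
Qed.

Lemma free_mod2 S a b : free_mod S [:: a; b] ->
  forall x y, x *: a + y *: b \in S -> x = 0 /\ y = 0.
Proof.
move=> fr x y h; have := fr (nth 0 [:: x; y]).
rewrite /= !big_ord_recl big_ord0 /= addr0 => /(_ h) c0.
by split; [apply: (c0 0%N)|apply: (c0 1%N)].
Qed.

Lemma free_mod4 S a b c d : free_mod S [:: a; b; c; d] ->
  forall x y z t, x *: a + y *: b + z *: c + t *: d \in S ->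
  [/\ x = 0, y = 0, z = 0 & t = 0].
Proof.
move=> fr x y z t h; have := fr (nth 0 [:: x; y; z; t]).
rewrite /= !big_ord_recl big_ord0 /= addr0 !addrA => /(_ h) c0.
by split; [apply: (c0 0%N)|apply: (c0 1%N)|apply: (c0 2%N)|apply: (c0 3%N)].
Qed.
End LinearAlgebra.

(** * Counting inequalities and their equality cases *)

Lemma leq_sum_eq (I : finType) (P : pred I) (a b : I -> nat) :
  (forall i, P i -> (a i <= b i)%N) ->
  (\sum_(i | P i) b i <= \sum_(i | P i) a i)%N ->
  forall i, P i -> a i = b i.
Proof.
move=> ab ba i Pi.
have lif j : P j -> (a j <= b j ?= iff (a j == b j))%N by move=> Pj; split; rewrite ?ab.
have := geq_leqif (leqif_sum lif); rewrite ba => /esym/forall_inP /(_ i Pi).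
by move/eqP.
Qed.

(** Meant for subspaces of dimensions [d] and [e] that meet in dimension [c] inside a space of
    dimension [n]; the last hypothesis says that their sum fits. With [k = n - d - 1] the left side
    is at most [p ^ k * (p ^ d.+1 - p ^ c.+1)], and [e <= k + c + 1]. *)
Lemma expn_codim_bound p n d e c : (1 < p)%N -> (d < n)%N -> (d + e <= c + n)%N ->
  (p * (p ^ d - p ^ c) <= p ^ n - p ^ e)%N.
Proof.
move=> p1 dn h; have [k nE] : exists k, n = (d + k).+1 by exists (n - d.+1)%N; lia.
have p0 : (0 < p)%N by lia.
rewrite mulnBr -!expnS.
apply: (@leq_trans (p ^ k * (p ^ d.+1 - p ^ c.+1))).
  by rewrite leq_pmull ?expn_gt0 ?p0.
rewrite mulnBr -!expnD; have -> : (k + d.+1 = n)%N by lia.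
by apply: leq_sub2l; rewrite leq_exp2l //; lia.
Qed.

(** If [d.+1 < n], the left side is less than [p ^ d.+1], which is at most half of [p ^ n], while
    the right side is at least that half. Once [d.+1 = n], the subtracted powers must agree. *)
Lemma expn_codim_eq p n d e c : (1 < p)%N -> (d < n)%N -> (e < n)%N ->
  (p * (p ^ d - p ^ c) = p ^ n - p ^ e)%N -> d.+1 = n /\ c.+1 = e.
Proof.
move=> p1 dn en; rewrite mulnBr -!expnS => h.
have hn : (p ^ e < p ^ n)%N by rewrite ltn_exp2l.
have hen : (p * p ^ e <= p ^ n)%N by rewrite -expnS leq_exp2l.
have e0 : (0 < p ^ e)%N by rewrite expn_gt0 (ltnW p1).
have c0 : (0 < p ^ c.+1)%N by rewrite expn_gt0 (ltnW p1).
have dE : d.+1 = n.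
  apply/eqP; rewrite eqn_leq dn leqNgt; apply/negP => lt.
  have h2 : (p * p ^ d.+1 <= p ^ n)%N by rewrite -expnS leq_exp2l.
  have h3 : (2 * p ^ d.+1 <= p ^ n)%N by apply: leq_trans h2; rewrite leq_mul2r p1 orbT.
  have h4 : (2 * p ^ e <= p ^ n)%N by apply: leq_trans hen; rewrite leq_mul2r p1 orbT.
  lia.
split=> //; rewrite dE in h.
apply/eqP; rewrite -(eqn_exp2l _ _ p1); lia.
Qed.

(** * Coverings by q + 1 proper subspaces *)

Section Cover.
Variables (K : finFieldType) (N : nat).
Local Notation vT := 'rV[K]_N.
Local Notation q := #|K|.
Implicit Types (X Y : {vspace vT}).

Lemma card_vspace_rV X : #|[pred w : vT | w \in X]| = (q ^ \dim X)%N.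
Proof. exact: card_vspace. Qed.

Lemma card_finField_gt1 : (1 < q)%N.
Proof. exact: finRing_gt1. Qed.

Lemma ord_neq_exists (i : 'I_q.+1) : exists j : 'I_q.+1, i != j.
Proof.
case: (eqVneq i ord0) => [->|i0]; last by exists ord0.
by exists ord_max; rewrite -val_eqE /= eq_sym -lt0n ltnW ?card_finField_gt1.
Qed.

Lemma card_vspace_diff X Y :
  #|[pred w : vT | (w \in X) && (w \notin Y)]| = (q ^ \dim X - q ^ \dim (X :&: Y))%N.
Proof.
rewrite -!card_vspace_rV -(cardID [pred w | w \in Y] [pred w | w \in X]).
set a := #|_|; set b := #|_|; set c := #|_|; set d := #|_|.
have -> : d = a by apply: eq_card => w; rewrite !inE memv_cap.
by rewrite addKn; apply: eq_card => w; rewrite !inE andbC.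
Qed.

Variables (X : {vspace vT}) (Y : 'I_q.+1 -> {vspace vT}).
Hypothesis Ysub : forall i, (Y i <= X)%VS.
Hypothesis Yneq : forall i, Y i != X.
Hypothesis Ycover : forall w, w \in X -> exists i, w \in Y i.

Lemma cover_dim_lt i : (\dim (Y i) < \dim X)%N.
Proof.
by rewrite ltn_neqAle dimvS // andbT (dimv_leqif_eq (Ysub i)) Yneq.
Qed.

(* Counting [X \ Y i0] against the [q] sets [Y i \ Y i0], each of which has at
   most [#|X \ Y i0| / q] elements, forces equality everywhere. *)
Lemma cover_count i0 :
  (forall i, i != i0 ->
    (\dim (Y i)).+1 = \dim X /\ (\dim (Y i :&: Y i0)).+1 = \dim (Y i0)) /\
  (forall i j w, i != i0 -> j != i0 -> i != j ->
    w \in Y i -> w \in Y j -> w \in Y i0).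
Proof.
pose D i := [pred w | (w \in Y i) && (w \notin Y i0)].
pose DX := [pred w | (w \in X) && (w \notin Y i0)].
have sumD : (\sum_(i | i != i0) #|D i| = \sum_w \sum_(i | i != i0) D i w)%N.
  by rewrite exchange_big; apply: eq_bigr => i _ /=; rewrite -sum1_card big_mkcond.
have sumX : (#|DX| = \sum_w DX w)%N.
  by rewrite -sum1_card big_mkcond.
have DXle w : (DX w <= \sum_(i | i != i0) D i w)%N.
  rewrite /DX /=; case: andP => // -[wX wi0]; have [i wi] := Ycover wX.
  have ii0 : i != i0 by apply: contraNneq wi0 => <-.
  by rewrite (bigD1 i) //= wi wi0 leq_addr.
(* The dimension condition of [expn_codim_bound] becomes [\dim (Y i + Y i0) <= \dim X]. *)
have Dle i : i != i0 -> (q * #|D i| <= #|DX|)%N.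
  move=> _; rewrite /D /DX !card_vspace_diff (capv_idPr (Ysub i0)).
  apply: expn_codim_bound; rewrite ?card_finField_gt1 ?cover_dim_lt //.
  rewrite -dimv_sum_cap addnC leq_add2l dimvS //.
  by apply/subvP/subvP; rewrite subv_add !Ysub.
have sumle : (#|DX| <= \sum_(i | i != i0) #|D i|)%N.
  by rewrite sumX sumD; apply: leq_sum.
have cst : (\sum_(i < q.+1 | i != i0) #|DX| = q * #|DX|)%N.
  by rewrite sum_nat_const cardC1 card_ord.
have Deq : forall i, i != i0 -> (q * #|D i| = #|DX|)%N.
  by apply: leq_sum_eq => //; rewrite cst -big_distrr /= leq_mul2l sumle orbT.
split=> [i ii0|i j w ii0 ji0 ij wi wj].
  have := Deq i ii0; rewrite /D /DX !card_vspace_diff (capv_idPr (Ysub i0)).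
  by apply: expn_codim_eq; rewrite ?card_finField_gt1 ?cover_dim_lt.
(* Equality in the total count means that no vector outside [Y i0] is counted twice. *)
have sumeq : (\sum_w \sum_(i | i != i0) D i w <= \sum_w DX w)%N.
  rewrite -sumD -sumX -(leq_pmul2l (ltnW card_finField_gt1)) big_distrr /= -cst.
  by apply: eq_leq; apply: eq_bigr.
apply/negPn/negP => wi0.
have := leq_sum_eq (fun w _ => DXle w) sumeq (isT : xpredT w).
move=> /(_ w); rewrite (bigD1 i) //= (bigD1 j) /=; last by rewrite ji0 eq_sym.
by rewrite wi wj wi0 /=; case: (_ \in X) => /=; lia.
Qed.

Lemma cover_dim i : (\dim (Y i)).+1 = \dim X.
Proof.
by have [j ij] := ord_neq_exists i; have [/(_ i ij)[]] := cover_count j.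
Qed.

Lemma cover_cap_dim i j : i != j -> (\dim (Y i :&: Y j)).+2 = \dim X.
Proof.
by move=> ij; have [/(_ i ij)[_ ->] _] := cover_count j; rewrite cover_dim.
Qed.

Lemma cover_cap_sub i j k : i != j -> (Y i :&: Y j <= Y k)%VS.
Proof.
move=> ij; apply/subvP => w /memv_capP[wi wj].
case: (eqVneq i k) => [<- //|ik]; case: (eqVneq j k) => [<- //|jk].
by have [_ h] := cover_count k; apply: (h i j).
Qed.
End Cover.

(** * Solutions of the isometry equation *)

Section Solutions.
Variables (K : finFieldType) (N : nat).
Local Notation vT := 'rV[K]_N.
Local Notation q := #|K|.
Implicit Types (U V : 'I_q.+1 -> {vspace vT}).

Definition weighted_eq U V := forall w : vT,
  \sum_i (q ^ \dim (V i))%:R^-1 * (w \in V i)%:R =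
  \sum_i (q ^ \dim (U i))%:R^-1 * (w \in U i)%:R :> rat.

(* [q ^ n] times the value at [w] of the term of [X] in the isometry equation;
   meaningful only if [\dim X <= n], since the subtraction is truncated. *)
Definition weight n (X : {vspace vT}) (w : vT) := (q ^ (n - \dim X) * (w \in X))%N.

Definition weight_eq n U V :=
  forall w, (\sum_i weight n (V i) w = \sum_i weight n (U i) w)%N.

(** Multiplying by [q ^ n] clears the denominators; since [n] bounds all dimensions, the truncated
    exponents in [weight] are exact. *)
Lemma weighted_eq_nat n U V : (forall i, \dim (U i) <= n)%N ->
  (forall i, \dim (V i) <= n)%N -> weighted_eq U V -> weight_eq n U V.
Proof.
move=> dU dV UV w; apply/eqP; rewrite -(eqr_nat rat) !natr_sum; apply/eqP.
have E T : (forall i : 'I_q.+1, \dim (T i) <= n)%N ->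
    \sum_i (weight n (T i) w)%:R =
    (q ^ n)%:R * \sum_i (q ^ \dim (T i))%:R^-1 * (w \in T i)%:R :> rat.
  move=> dT; rewrite big_distrr /=; apply: eq_bigr => i _.
  rewrite mulrA natrM; congr (_ * _).
  rewrite -{2}(subnK (dT i)) expnD natrM mulfK // pnatr_eq0 -lt0n expn_gt0.
  by rewrite (ltnW (card_finField_gt1 K)).
by rewrite !E // UV.
Qed.

(** Grouping equal members allows the two sides of the equation to be compared subspace by subspace,
    through multiplicities. *)
Lemma sum_codom (U : 'I_q.+1 -> {vspace vT}) (D : seq {vspace vT}) (f : {vspace vT} -> nat) :
  uniq D -> {subset codom U <= D} ->
  (\sum_i f (U i) = \sum_(Y <- D) count_mem Y (codom U) * f Y)%N.
Proof.
move=> uD sD.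
transitivity (\sum_i \sum_(Y <- D) (U i == Y) * f Y)%N.
  apply: eq_bigr => i _; rewrite (bigD1_seq (U i)) //=; last by rewrite sD ?codom_f.
  by rewrite eqxx mul1n big1 ?addn0 // => Y /negPf; rewrite eq_sym => ->.
rewrite exchange_big /=; apply: eq_bigr => Y _; rewrite -big_distrl /=; congr (_ * _)%N.
rewrite -sum1_count big_map big_enum_cond /= [RHS]big_mkcond /=.
by apply: eq_bigr => i _; case: eqP.
Qed.

Lemma weight_eq_sym n U V : weight_eq n U V -> weight_eq n V U.
Proof. by move=> h w; rewrite h. Qed.

(** If no [U j] through [w] occurred more often in [U], every subspace would contribute at least as
    much on the side of [V], and [X] strictly more. *)
Lemma excess_cover n U V (X : {vspace vT}) (w : vT) : weight_eq n U V ->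
  (count_mem X (codom U) < count_mem X (codom V))%N -> w \in X ->
  exists2 j : 'I_q.+1, w \in U j & (count_mem (U j) (codom V) < count_mem (U j) (codom U))%N.
Proof.
move=> UV ltX wX; apply: contrapT => noex.
have noj j : w \in U j -> ~~ (count_mem (U j) (codom V) < count_mem (U j) (codom U))%N.
  by move=> wj; apply/negP => lt; apply: noex; exists j.
pose D := undup (codom U ++ codom V).
have uD : uniq D by apply: undup_uniq.
have sU : {subset codom U <= D} by move=> Y YU; rewrite mem_undup mem_cat YU.
have sV : {subset codom V <= D} by move=> Y YV; rewrite mem_undup mem_cat YV orbT.
have XD : X \in D by apply: sV; rewrite -has_pred1 has_count; lia.
have := UV w; rewrite (sum_codom (fun Y => weight n Y w) uD sU).
rewrite (sum_codom (fun Y => weight n Y w) uD sV).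
rewrite !(bigD1_seq X XD uD) /= => E.
have : (\sum_(Y <- D | Y != X) count_mem Y (codom U) * weight n Y w <=
        \sum_(Y <- D | Y != X) count_mem Y (codom V) * weight n Y w)%N.
  apply: leq_sum => Y _; case: (leqP (count_mem Y (codom U)) (count_mem Y (codom V))).
    by move=> le; rewrite leq_mul2r le orbT.
  move=> lt; have : Y \in codom U by rewrite -has_pred1 has_count; lia.
  move=> /codomP[j Yj]; have wj : w \notin U j.
    by apply/negP => /noj; rewrite -Yj lt.
  by rewrite /weight Yj (negPf wj) !muln0.
have w0 : (0 < weight n X w)%N.
  by rewrite /weight wX muln1 expn_gt0 (ltnW (card_finField_gt1 K)).
have : (count_mem X (codom U) * weight n X w < count_mem X (codom V) * weight n X w)%N.
  by rewrite ltn_mul2r w0.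
by move=> h1 h2; have := leq_add h1 h2; rewrite addSn E ltnn.
Qed.

Lemma excess_disjoint n U V (X : {vspace vT}) : weight_eq n U V ->
  (count_mem X (codom U) < count_mem X (codom V))%N ->
  (forall Y, count_mem Y (codom U) != count_mem Y (codom V) ->
    \dim Y <= \dim X)%N ->
  forall i j, U i != V j.
Proof.
move=> UV ltX maxX.
pose good j := (count_mem (U j) (codom V) < count_mem (U j) (codom U))%N.
have goodX j : good j -> (U j :&: X)%VS != X.
  move=> gj; apply/negP => /eqP/capv_idPr XU.
  have /maxX dU : count_mem (U j) (codom U) != count_mem (U j) (codom V).
    by rewrite neq_ltn; apply/orP; right; apply: gj.
  have XE : X = U j by apply/eqP; rewrite eqEdim XU.
  by move: ltX; rewrite XE ltnNge ltnW.
(* Indices without excess get the zero space, which is proper because [X] is nonzero. It is excluded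
   below: it would have codimension 1 as a member of the covering and codimension 2 as an
   intersection. *)
pose Y j := if good j then (U j :&: X)%VS else 0%VS.
have X0 : X != 0%VS.
  have [j wj gj] := excess_cover UV ltX (mem0v X).
  by apply: contraNneq (goodX j gj) => ->; rewrite capv0.
have Ysub j : (Y j <= X)%VS by rewrite /Y; case: ifP; rewrite ?capvSr ?sub0v.
have Yneq j : Y j != X.
  by rewrite /Y; case: ifP => [/goodX //|_]; rewrite eq_sym.
have Ycov w : w \in X -> exists j, w \in Y j.
  move=> wX; have [j wj gj] := excess_cover UV ltX wX.
  by exists j; rewrite /Y; have -> : good j = true by []; rewrite memv_cap wj.
have dY := cover_dim Ysub Yneq Ycov; have dYI := cover_cap_dim Ysub Yneq Ycov.
have allgood j : good j.
  apply/negPn/negP => nj; have [k jk] := ord_neq_exists j.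
  by have := dYI j k jk; rewrite -(dY j) /Y (negPf nj) cap0v dimv0.
have injU : injective U.
  move=> j k jk; apply/eqP; apply: contraT => /dYI.
  by rewrite -(dY k) /Y !allgood jk capvv => /eqP; rewrite eqn_leq ltnn.
move=> j i; apply/negP => /eqP ji.
have : (0 < count_mem (U j) (codom V))%N by rewrite -has_count has_pred1 ji codom_f.
have := allgood j; rewrite /good (@count_uniq_mem _ (codom U)) ?codom_f; last exact/injectiveP.
by case: (count_mem _ _).
Qed.

(** Apply [excess_disjoint] to a subspace of largest dimension among those whose two multiplicities
    differ; the tuples play symmetric roles. *)
Lemma nontrivial_disjoint n U V : weight_eq n U V ->
  ~~ perm_eq (codom U) (codom V) -> forall i j, U i != V j.
Proof.
move=> UV nperm.
pose P d := has (fun Y : {vspace vT} => (\dim Y == d) &&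
  (count_mem Y (codom U) != count_mem Y (codom V))) (codom U ++ codom V).
have exP : exists d, P d.
  move: nperm; rewrite /perm_eq -has_predC => /hasP[Y YD /= neq].
  by exists (\dim Y); apply/hasP; exists Y; rewrite // eqxx.
have ubP d : P d -> (d <= \dim {:vT})%N.
  by move=> /hasP[Y _ /andP[/eqP<- _]]; apply: dimvS (subvf _).
case: (ex_maxnP exP ubP) => d /hasP[X _ /andP[/eqP dX neqX]] maxd.
have maxX Y : count_mem Y (codom U) != count_mem Y (codom V) -> (\dim Y <= \dim X)%N.
  move=> neq; rewrite dX; apply: maxd; apply/hasP; exists Y; last by rewrite eqxx.
  rewrite mem_cat -!has_pred1 !has_count.
  by move: neq; do 2!case: (count_mem _ _).
move: neqX; rewrite neq_ltn => /orP[lt|lt]; first exact: excess_disjoint UV lt maxX.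
have maxX' Y : count_mem Y (codom V) != count_mem Y (codom U) -> (\dim Y <= \dim X)%N.
  by rewrite eq_sym; apply: maxX.
move=> i j; rewrite eq_sym.
exact: excess_disjoint (weight_eq_sym UV) lt maxX' _ _.
Qed.
End Solutions.

(** * Reduced solutions and Type A *)

Section Reduced.
Variables (K : finFieldType) (N : nat).
Local Notation vT := 'rV[K]_N.
Local Notation q := #|K|.
Implicit Types (U V : 'I_q.+1 -> {vspace vT}).

Lemma add_line_congr (S : {vspace vT}) (u v : vT) :
  u - v \in S -> (S + <[u]> = S + <[v]>)%VS.
Proof.
move=> uv; apply/eqP; rewrite eqEsubv !subv_add_line !addvSl /=.
apply/andP; split; apply/memv_add_lineP; exists 1; rewrite scale1r //.
by rewrite -opprB rpredN.
Qed.

(** Here [n] only bounds the dimensions; that it is attained is stated separately where it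
    matters. *)
Definition reduced n U V :=
  [/\ weight_eq n U V, forall i, (\dim (U i) <= n)%N, forall i, (\dim (V i) <= n)%N
    & forall i j, U i != V j].

Lemma reduced_sym n U V : reduced n U V -> reduced n V U.
Proof.
by case=> UV dU dV neq; split=> // i j; rewrite eq_sym.
Qed.

Lemma weight_gt0 n (X : {vspace vT}) (w : vT) : (0 < weight n X w)%N = (w \in X).
Proof.
by rewrite /weight muln_gt0 expn_gt0 (ltnW (card_finField_gt1 K)) /=; case: (w \in X).
Qed.

Lemma weight_notin n (X : {vspace vT}) (w : vT) : w \notin X -> weight n X w = 0%N.
Proof. by rewrite /weight => /negPf->; rewrite muln0. Qed.

Lemma weight_top n (X : {vspace vT}) (w : vT) :
  \dim X = n -> weight n X w = (w \in X).
Proof. by move=> <-; rewrite /weight subnn mul1n. Qed.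

Lemma weight_hyper n (X : {vspace vT}) (w : vT) :
  (\dim X).+1 = n -> weight n X w = (q * (w \in X))%N.
Proof. by move=> <-; rewrite /weight subSnn. Qed.

Lemma weight_eq_cover n U V i (w : vT) :
  weight_eq n U V -> w \in V i -> exists j, w \in U j.
Proof.
move=> UV wi; apply: contrapT => noj; have := UV w.
rewrite (bigD1 i) //= [RHS]big1 => [|j _]; last first.
  by apply/weight_notin/negP => wj; apply: noj; exists j.
by move/eqP; rewrite addn_eq0 -leqn0 leqNgt weight_gt0 wi.
Qed.

Section Top.
Variables (n : nat) (U V : 'I_q.+1 -> {vspace vT}) (i : 'I_q.+1).
Hypothesis red : reduced n U V.
Hypothesis dVi : \dim (V i) = n.

(** The traces [U j :&: V i] satisfy the hypotheses of the covering lemmas: a [U j] containing [V i]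
    would have dimension [n] and equal it. *)
Let subi j : (U j :&: V i <= V i)%VS. Proof. exact: capvSr. Qed.
Let neqi j : (U j :&: V i)%VS != V i.
Proof.
have [_ dU _ neq] := red; apply: contraNneq (neq j i) => /capv_idPr VU.
by rewrite eq_sym eqEdim VU dVi dU.
Qed.
Let covi w : w \in V i -> exists j, w \in (U j :&: V i)%VS.
Proof.
have [UV _ _ _] := red => wi; have [j wj] := weight_eq_cover UV wi.
by exists j; rewrite memv_cap wj.
Qed.

Lemma top_dim j : (\dim (U j :&: V i)).+1 = n.
Proof. by rewrite (cover_dim subi neqi covi j). Qed.

Lemma top_cap_dim j k : j != k -> (\dim (U j :&: V i :&: (U k :&: V i))).+2 = n.
Proof. by move=> /(cover_cap_dim subi neqi covi) ->. Qed.

Lemma top_cap_sub j k l : j != k -> (U j :&: V i :&: (U k :&: V i) <= U l)%VS.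
Proof.
by move=> /(cover_cap_sub subi neqi covi l) /subv_trans; apply; apply: capvSl.
Qed.

(** Equal members at distinct indices would have one trace on [V i], of codimension both 1 and 2. *)
Lemma top_inj : injective U.
Proof.
move=> j k jk; apply/eqP; apply: contraT => /top_cap_dim.
by rewrite -jk capvv -(top_dim j) => /eqP; rewrite eqn_leq ltnn.
Qed.

(** The trace of [U j] on [V i] already has dimension [n - 1], and [U j] is no larger. *)
Lemma top_sub j : \dim (U j) != n -> (U j <= V i)%VS.
Proof.
move=> dj; apply/capv_idPl/eqP; rewrite eqEdim capvSl /=.
have [_ dU _ _] := red; have := dU j; rewrite leq_eqVlt (negPf dj) /=.
by rewrite -{1}(top_dim j).
Qed.

Lemma top_dimE j : \dim (U j) != n -> (\dim (U j)).+1 = n.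
Proof. by move=> /top_sub/capv_idPl {1}<-; apply: top_dim. Qed.
End Top.

Lemma sum_nat_delta (i : 'I_q.+1) : (\sum_k (k == i) = 1)%N.
Proof. by rewrite (bigD1 i) //= eqxx big1 // => k /negPf->. Qed.

Lemma sum_nat_but1 (i : 'I_q.+1) c : (\sum_(k | k != i) c = q * c)%N.
Proof. by rewrite sum_nat_const cardC1 card_ord. Qed.

(** All [U j] are hyperplanes of [V i0] through the axis [S] of the pencil, and their union contains
    every [V i]. Evaluating the equation on [V i0] then identifies the [V i]. *)
Lemma caseA n U V i0 : reduced n U V -> \dim (V i0) = n ->
  (forall j, \dim (U j) != n) ->
  exists S a b i1, [/\ free_mod S [:: a; b], V i1 = S,
    forall i, i != i1 -> V i = (S + <[a]> + <[b]>)%VS &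
    forall j, exists x y : K, (x, y) != (0, 0) /\
      U j = (S + <[x *: a + y *: b]>)%VS].
Proof.
move=> red dVi0 dU; have [UV _ dV neq] := red.
have UX j : (U j <= V i0)%VS by apply: top_sub red dVi0 _ (dU j).
have dU1 j : (\dim (U j)).+1 = n by apply: top_dimE red dVi0 _ (dU j).
have UI j : (U j :&: V i0)%VS = U j by apply/capv_idPl.
have q1 := card_finField_gt1 K.
pose j0 := @ord0 q; have [j1 j01] := ord_neq_exists j0.
pose S := (U j0 :&: U j1)%VS.
have SU l : (S <= U l)%VS.
  by have := top_cap_sub red dVi0 l j01; rewrite !UI.
have dS : (\dim S).+2 = n by have := top_cap_dim red dVi0 j01; rewrite !UI.
have UUS j k : j != k -> (U j :&: U k <= S)%VS.
  move=> jk; rewrite subv_cap.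
  by have := fun l => top_cap_sub red dVi0 l jk; rewrite !UI => h; rewrite !h.
have VX i : (V i <= V i0)%VS.
  apply/subvP => w /(weight_eq_cover UV)[j].
  exact: (subvP (UX j)).
have wU w : (\sum_j weight n (U j) w = \sum_j q * (w \in U j))%N.
  by apply: eq_bigr => j _; rewrite weight_hyper.
(* At the zero vector the side of [U] is [(q + 1) * q], whereas [V] would give [q + 1] if all its
   members were [V i0]. *)
have [i1 Vi1] : exists i1, V i1 != V i0.
  apply: contrapT => all0; have := UV 0; rewrite wU.
  have -> : (\sum_i weight n (V i) 0%R = \sum_(i < q.+1) 1)%N.
    apply: eq_bigr => i _; rewrite weight_top ?mem0v //.
    by rewrite -dVi0; congr (\dim _); apply/eqP/negPn/negP => h; apply: all0; exists i.
  have -> : (\sum_i q * (0%R \in U i) = \sum_(i < q.+1) q)%N.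
    by apply: eq_bigr => i _; rewrite mem0v muln1.
  by rewrite !sum_nat_const card_ord; nia.
(* If two members differed from [V i0], a vector of [V i0] outside all such members would get at
   most [q - 1] from [V] but at least [q] from [U]. So these members cover [V i0]; but [Y] takes the
   value [V i1] at both [i0] and [i1], whereas distinct indices of a covering meet in codimension
   2. *)
have VE i : i != i1 -> V i = V i0.
  move=> ii1; apply/eqP/negPn/negP => Vi.
  pose Y k := if V k == V i0 then V i1 else V k.
  have Ysub k : (Y k <= V i0)%VS by rewrite /Y; case: ifP.
  have Yneq k : Y k != V i0 by rewrite /Y; case: ifP => // /negPf->.
  have Ycov w : w \in V i0 -> exists k, w \in Y k.
    move=> wX; apply: contrapT => noY.
    have noV k : V k != V i0 -> w \notin V k.
      by move=> Vk; apply/negP => wk; apply: noY; exists k; rewrite /Y (negPf Vk).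
    have le : (\sum_k (weight n (V k) w + ((k == i) + (k == i1))) <= \sum_(k < q.+1) 1)%N.
      apply: leq_sum => k _; case: (eqVneq k i) => [->|ki].
        by rewrite weight_notin ?noV // (negPf ii1).
      case: (eqVneq k i1) => [->|ki1]; first by rewrite weight_notin ?noV.
      case: (eqVneq (V k) (V i0)) => [->|Vk]; last by rewrite weight_notin ?noV.
      by rewrite weight_top // wX.
    have [j wj] := weight_eq_cover UV wX.
    have ge : (q <= \sum_k weight n (V k) w)%N.
      by rewrite UV wU (bigD1 j) //= wj muln1 leq_addr.
    move: le; rewrite !big_split /= !sum_nat_delta sum_nat_const card_ord muln1.
    by rewrite addnA !addn1 ltnS => le; have := leq_trans le ge; rewrite ltnn.
  have i01 : i0 != i1 by apply: contraNneq Vi1 => ->.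
  have := cover_cap_dim Ysub Yneq Ycov i01.
  rewrite /Y eqxx (negPf Vi1) capvv -(cover_dim Ysub Yneq Ycov i1) /Y (negPf Vi1).
  by move/eqP; rewrite eqn_leq ltnn.
have wV w : w \in V i0 -> (\sum_i weight n (V i) w = weight n (V i1) w + q)%N.
  move=> wX; rewrite (bigD1 i1) //=; congr (_ + _)%N.
  rewrite -[RHS]muln1 -(sum_nat_but1 i1); apply: eq_bigr => i ii1.
  by rewrite VE // weight_top // wX.
(* A vector of [V i0] outside [S] lies in a single [U j], so the side of [U] is [q] and nothing is
   left for [V i1]. On [S] it is [q * (q + 1)], so [V i1] must contribute. *)
have ViS : V i1 = S.
  apply/eqP; rewrite eqEsubv; apply/andP; split; apply/subvP => w wi.
    have wX := subvP (VX i1) w wi.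
    have [j wj] := weight_eq_cover UV wi.
    apply/negPn/negP => wS; have := UV w; rewrite wV // wU (bigD1 j) //= wj big1.
      move/eqP; rewrite addn0 muln1 -{2}[q]add0n eqn_add2r -leqn0 leqNgt weight_gt0.
      by rewrite wi.
    move=> k kj; case: (boolP (w \in U k)) => [wk|]; last by rewrite muln0.
    by case/negP: wS; apply: (subvP (UUS _ _ kj)); rewrite memv_cap wk wj.
  rewrite -(weight_gt0 n) lt0n; apply/negP => /eqP w0.
  have wX : w \in V i0 by apply: (subvP (UX j0)); apply: (subvP (SU j0)).
  have := UV w; rewrite wV // wU w0.
  have -> : (\sum_i q * (w \in U i) = \sum_(i < q.+1) q)%N.
    by apply: eq_bigr => i _; rewrite (subvP (SU i) _ wi) muln1.
  by rewrite sum_nat_const card_ord; nia.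
have [|a aS Ua] := dimv_codim1_line (SU j0).
  by apply/eqP; rewrite -eqSS dU1 dS.
have [|b bU Xb] := dimv_codim1_line (UX j0); first by rewrite dU1.
exists S, a, b, i1; split=> //.
- by apply: free_mod_cons => //; rewrite -Ua; apply: free_mod_cons => //; apply: free_mod0.
- by move=> i /VE->; rewrite Xb Ua.
move=> j; have [|u uS Uu] := dimv_codim1_line (SU j).
  by apply/eqP; rewrite -eqSS dU1 dS.
have : u \in V i0 by apply: (subvP (UX j)); rewrite Uu (subvP (addvSr _ _)) ?memv_line.
rewrite Xb Ua => /memv_add_line2P[x [y h]]; exists x, y; split.
  apply: contraNneq uS => -[x0 y0]; move: h.
  by rewrite x0 y0 !scale0r !subr0.
by rewrite Uu; apply: add_line_congr; rewrite opprD addrA.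
Qed.
End Reduced.

(** * Type B *)

Section CaseB.
Variables (K : finFieldType) (N : nat).
Local Notation vT := 'rV[K]_N.
Local Notation q := #|K|.
Implicit Types (U V : 'I_q.+1 -> {vspace vT}).

Lemma ord_neq2_exists (i k : 'I_q.+1) : exists j, j != i /\ j != k.
Proof.
have [j] : exists j, j \notin [set i; k]%SET.
  apply: contrapT => all2; have : (#|'I_q.+1| <= #|[set i; k]%SET|)%N.
    apply: subset_leq_card; apply/fintype.subsetP => j _.
    by apply/negPn/negP => h; apply: all2; exists j.
  rewrite card_ord cards2; have := card_finField_gt1 K; case: (i != k) => /= h1 h2.
    by have := leq_trans h1 h2.
  by have := leq_trans h1 (ltnW h2).
by rewrite !inE negb_or => /andP; exists j.
Qed.

(** Call a member top if its dimension is [n] and low otherwise. Two low members of [V] lie in every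
    top [U k] and, being distinct of dimension [n - 1], span it; injectivity of [U] leaves only one
    such [k]. *)
Lemma low_pair_top n U V i0 j0 i1 i2 : reduced n U V -> \dim (V i0) = n ->
  \dim (U j0) = n -> i1 != i2 -> \dim (V i1) != n -> \dim (V i2) != n ->
  forall j, j != j0 -> \dim (U j) != n.
Proof.
move=> red dVi0 dUj0 i12 dV1 dV2 j; apply: contraNneq => dUj.
have red' := reduced_sym red; have [_ dU _ _] := red.
have UE k : \dim (U k) = n -> (V i1 + V i2)%VS = U k.
  move=> dUk.
  have sub : (V i1 + V i2 <= U k)%VS by rewrite subv_add !(top_sub red' dUk).
  apply/eqP; rewrite eqEdim sub dUk -(top_dimE red' dUk dV1).
  rewrite ltn_neqAle dimvS ?addvSl // andbT.
  rewrite (dimv_leqif_eq (addvSl _ _)); apply: contra i12 => /eqP E.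
  rewrite -(inj_eq (top_inj red' dUk)) eq_sym eqEdim -ltnS.
  by rewrite (top_dimE red' dUk dV1) (top_dimE red' dUk dV2) leqnn andbT E addvSr.
by rewrite -(inj_eq (top_inj red dVi0)) -(UE _ dUj) (UE _ dUj0).
Qed.

(** With two low members in [V], [low_pair_top] makes [U j0] the only top member of [U]; the other
    [q >= 2] members are low, so [V i0] is the only top member of [V]. At a vector of [U j0] outside
    [V i0] the side of [U] is 1 and that of [V] is a multiple of [q]. *)
Lemma low_unique n U V i0 j0 i1 : reduced n U V -> \dim (V i0) = n ->
  \dim (U j0) = n -> \dim (V i1) != n -> forall i, i != i1 -> \dim (V i) = n.
Proof.
move=> red dVi0 dUj0 dV1 i ii1; apply/eqP/negPn/negP => dVi.
have red' := reduced_sym red; have [UV _ _ neq] := red.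
have lowU := low_pair_top red dVi0 dUj0 ii1 dVi dV1.
have [j1 [j10 _]] := ord_neq2_exists j0 j0.
have [j2 [j20 j21]] := ord_neq2_exists j0 j1.
have lowV := low_pair_top red' dUj0 dVi0 j21 (lowU _ j20) (lowU _ j10).
have /subvPn[w wU wV] : ~~ (U j0 <= V i0)%VS.
  by apply: contra (neq j0 i0) => sub; rewrite eqEdim sub dVi0 dUj0 /=.
have := UV w; rewrite (bigD1 i0) //= (weight_notin _ wV) add0n.
rewrite [RHS](bigD1 j0) //= weight_top // wU [X in (_ + X)%N]big1 => [|j jj0]; last first.
  apply: weight_notin; apply: contra wV.
  exact: (subvP (top_sub red dVi0 (lowU _ jj0))).
rewrite (eq_bigr (fun i => q * (w \in V i))%N) => [|k ki0]; last first.
  by rewrite weight_hyper // (top_dimE red' dUj0 (lowV _ ki0)).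
rewrite -big_distrr /= addn0 => /eqP; rewrite muln_eq1 => /andP[/eqP q1 _].
by have := card_finField_gt1 K; rewrite q1.
Qed.

(** At the zero vector every weight is at least 1 and that of [V i1] is [q], while top members alone
    would give only [q + 1]. *)
Lemma low_exists n U V i1 : reduced n U V -> (\dim (V i1)).+1 = n ->
  exists j1, \dim (U j1) != n.
Proof.
move=> [UV _ _ _] dV1; apply: contrapT => noj.
have dU j : \dim (U j) = n by apply/eqP/negPn/negP => h; apply: noj; exists j.
have := @leq_sum_eq _ xpredT (fun=> 1%N) (fun i => weight n (V i) 0).
rewrite UV => /(_ _ _ i1 isT) E.
have : 1%N = weight n (V i1) 0.
  apply: E => [i _|]; first by rewrite weight_gt0 mem0v.
  by apply: leq_sum => j _; rewrite weight_top // mem0v.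
by rewrite weight_hyper // mem0v muln1 => q1; have := card_finField_gt1 K; rewrite -q1.
Qed.

(** [V i1] lies in every top [U j], so by dimension it is the intersection of two of them. Hence
    [V i :&: V i1] is the axis of the pencil on [V i], which lies in [U j1]; conversely [U j1] lies
    in [V i]. *)
Lemma low_cap n U V i1 j1 : reduced n U V ->
  (forall i, i != i1 -> \dim (V i) = n) -> (forall j, j != j1 -> \dim (U j) = n) ->
  \dim (V i1) != n -> \dim (U j1) != n -> forall i, i != i1 ->
  (V i :&: V i1 = U j1 :&: V i1)%VS /\ (\dim (U j1 :&: V i1)).+2 = n.
Proof.
move=> red dV dU dV1 dU1 i ii1; have red' := reduced_sym red.
have [j [jj1 _]] := ord_neq2_exists j1 j1.
have [k [kj1 kj]] := ord_neq2_exists j1 j.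
have UUE : (U k :&: U j)%VS = V i1.
  apply/eqP; rewrite eq_sym eqEdim subv_cap.
  rewrite !(top_sub red') ?dU //= -ltnS (top_dimE red' (dU _ jj1) dV1).
  rewrite -(dU _ kj1) ltn_neqAle dimvS ?capvSl // andbT.
  rewrite (dimv_leqif_eq (capvSl _ _)); apply: contra kj => /eqP/capv_idPl kj.
  by rewrite -(inj_eq (top_inj red (dV _ ii1))) eqEdim kj !dU /=.
have capE : (U k :&: V i :&: (U j :&: V i))%VS = (V i :&: V i1)%VS.
  rewrite -UUE; apply/vspaceP => w; rewrite !memv_cap.
  by case: (w \in U k); case: (w \in V i); rewrite /= ?andbF ?andbT.
have E : (V i :&: V i1 = U j1 :&: V i1)%VS.
  apply/eqP; rewrite eqEsubv !subv_cap !capvSr !andbT -capE.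
  rewrite (top_cap_sub red (dV _ ii1)) //.
  by rewrite (subv_trans (capvSl _ _)) // (top_sub red (dV _ ii1)).
by split; rewrite // -E -capE (top_cap_dim red (dV _ ii1)).
Qed.

(** Modulo [S], [T] meets the span of [b] and [c] in one line. Its generator has a nonzero
    coefficient at [c], because [b] is not in [T]; scale it to 1. *)
Lemma add_line2_form (S T : {vspace vT}) (a b c : vT) : (S <= T)%VS ->
  a \in T -> b \notin T -> \dim T = (\dim S).+2 ->
  a \notin (S + <[b]> + <[c]>)%VS ->
  \dim (T :&: (S + <[b]> + <[c]>)) = (\dim S).+1 ->
  exists x, T = (S + <[a]> + <[x *: b + c]>)%VS.
Proof.
set X := (S + <[b]> + <[c]>)%VS => ST aT bT dT aX dTX.
have SX : (S <= X)%VS by rewrite /X -addvA addvSl.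
have [|u /memv_capP[uT uX] uS] := @dimv_lt_notin _ _ S (T :&: X); first by rewrite dTX.
have /memv_add_line2P[y [z h]] := uX.
set v := y *: b + z *: c.
have {}h : u - v \in S by rewrite opprD addrA.
have vT' : v \in T by have := rpredB uT (subvP ST _ h); rewrite subKr.
have z0 : z != 0.
  apply: contraNneq uS => z0; move: vT' h; rewrite /v z0 scale0r addr0.
  by rewrite rpredZeq (negPf bT) orbF => /eqP->; rewrite scale0r subr0.
have wE : (z^-1 * y) *: b + c = z^-1 *: v.
  by rewrite /v scalerDr !scalerA mulVf // scale1r.
have vX : v \in X.
  by have := rpredB uX (subvP SX _ h); rewrite subKr.
have vS : v \notin S.
  by apply: contra uS => vS; have := rpredD h vS; rewrite subrK.
exists (z^-1 * y); rewrite wE; apply: eq_add_line2 => //.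
- by rewrite rpredZ.
- by apply: contra aX; apply: (subvP SX).
apply/negP => /memv_add_lineP[x].
case: (eqVneq x 0) => [->|x0 hS].
  by rewrite scale0r subr0 rpredZeq invr_eq0 (negPf z0) (negPf vS).
case/negP: aX; rewrite -(scalerK x0 a) rpredZ //.
have := rpredB (rpredZ z^-1 vX) (subvP SX _ hS).
by rewrite opprB addrC subrK.
Qed.

(** Modulo [S = U j1 :&: V i1], the vector [a] spans [V i1], [b] spans [U j1], and [c] spans
    [U j2 :&: V i2] for one fixed pair of top members. Intersecting with [U j2] and [V i2] puts all
    top members in the form of [add_line2_form]. *)
Lemma caseB n U V i0 j0 i1 : reduced n U V -> \dim (V i0) = n ->
  \dim (U j0) = n -> \dim (V i1) != n ->
  exists S a b c j1, [/\ free_mod S [:: a; b; c],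
    V i1 = (S + <[a]>)%VS, U j1 = (S + <[b]>)%VS,
    forall i, i != i1 -> exists x, V i = (S + <[b]> + <[x *: a + c]>)%VS &
    forall j, j != j1 -> exists x, U j = (S + <[a]> + <[x *: b + c]>)%VS].
Proof.
move=> red dVi0 dUj0 dV1; have red' := reduced_sym red.
have dV1S := top_dimE red' dUj0 dV1.
have [j1 dU1] := low_exists red dV1S.
have dU1S := top_dimE red dVi0 dU1.
have dV := low_unique red dVi0 dUj0 dV1.
have dU := low_unique red' dUj0 dVi0 dU1.
pose S := (U j1 :&: V i1)%VS.
have capV i : i != i1 -> (V i :&: V i1)%VS = S.
  by move=> ii1; have [] := low_cap red dV dU dV1 dU1 ii1.
have capU j : j != j1 -> (U j :&: U j1)%VS = S.
  by move=> jj1; have [->] := low_cap red' dU dV dU1 dV1 jj1; rewrite capvC.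
have [i2 [i21 _]] := ord_neq2_exists i1 i1.
have [j2 [j21 _]] := ord_neq2_exists j1 j1.
have dS : (\dim S).+2 = n by have [] := low_cap red dV dU dV1 dU1 i21.
have UV1 i : i != i1 -> (U j1 <= V i)%VS by move=> /dV dVi; apply: top_sub red dVi _ dU1.
have VU1 j : j != j1 -> (V i1 <= U j)%VS by move=> /dU dUj; apply: top_sub red' dUj _ dV1.
have SV i : i != i1 -> (S <= V i)%VS by move=> /UV1; apply: subv_trans; apply: capvSl.
have SU j : j != j1 -> (S <= U j)%VS by move=> /VU1; apply: subv_trans; apply: capvSr.
have [|a aS Va] := dimv_codim1_line (capvSr _ _ : (S <= V i1)%VS).
  by apply/eqP; rewrite -eqSS dS dV1S.
have [|b bS Ub] := dimv_codim1_line (capvSl _ _ : (S <= U j1)%VS).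
  by apply/eqP; rewrite -eqSS dS dU1S.
have aV1 : a \in V i1 by rewrite Va (subvP (addvSr _ _)) ?memv_line.
have bU1 : b \in U j1 by rewrite Ub (subvP (addvSr _ _)) ?memv_line.
have aU j : j != j1 -> a \in U j by move=> /VU1/subvP; apply.
have bV i : i != i1 -> b \in V i by move=> /UV1/subvP; apply.
have aV i : i != i1 -> a \notin V i.
  by move=> ii1; apply: contra aS => aV; rewrite -(capV _ ii1) memv_cap aV.
have bU j : j != j1 -> b \notin U j.
  by move=> jj1; apply: contra bS => bU; rewrite -(capU _ jj1) memv_cap bU.
have dUV i j : i != i1 -> \dim (U j :&: V i) = (\dim S).+1.
  by move=> ii1; apply/eqP; rewrite -eqSS dS (top_dim red (dV _ ii1)).
have [||c cS Cc] := @dimv_codim1_line _ _ S (U j2 :&: V i2).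
- by rewrite subv_cap SU // SV.
- by rewrite dUV.
have /memv_capP[cU cV] : c \in (U j2 :&: V i2)%VS.
  by rewrite Cc (subvP (addvSr _ _)) ?memv_line.
have cSb : c \notin (S + <[b]>)%VS.
  by rewrite -Ub; apply: contra cS => cU1; rewrite -(capU _ j21) memv_cap cU.
have cSa : c \notin (S + <[a]>)%VS.
  by rewrite -Va; apply: contra cS => cV1; rewrite -(capV _ i21) memv_cap cV.
have Vbc : V i2 = (S + <[b]> + <[c]>)%VS.
  by apply: eq_add_line2; rewrite ?SV ?bV // dV.
have Uac : U j2 = (S + <[a]> + <[c]>)%VS.
  by apply: eq_add_line2; rewrite ?SU ?aU // dU.
exists S, a, b, c, j1; split=> //.
- apply: free_mod_cons => //; apply: free_mod_cons.
    by apply: contra bS; rewrite -Va memv_cap bU1.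
  apply: free_mod_cons; last exact: free_mod0.
  apply/negP => /memv_add_line2P[x [y h]].
  have xa : x *: a \in V i2.
    have := rpredB (rpredB cV (rpredZ y (bV _ i21))) (subvP (SV _ i21) _ h).
    by rewrite [c - x *: a - _]addrAC subKr.
  case/negP: cSb; apply/memv_add_lineP; exists y.
  move: xa h; rewrite rpredZeq (negPf (aV _ i21)) orbF => /eqP->.
  by rewrite scale0r subr0.
- move=> i ii1; apply: add_line2_form; rewrite ?SV ?bV ?aV ?dV -?Uac //.
    exact: bU.
  by rewrite capvC dUV.
move=> j jj1; apply: add_line2_form; rewrite ?SU ?bU ?aU ?dU -?Vbc //.
  exact: aV.
exact: dUV.
Qed.
End CaseB.

(** * Type C *)

Section Regulus.
Variables (K : fieldType) (vT : vectType K).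
Implicit Types (S T Z : {vspace vT}) (a b c d : vT).

Lemma lineZ k (v : vT) : k != 0 -> (<[k *: v]> = <[v]>)%VS.
Proof.
move=> k0; apply/eqP; rewrite eqEsubv -!memvE; apply/andP; split.
  by apply: rpredZ; apply: memv_line.
have : k^-1 *: (k *: v) \in <[k *: v]>%VS by apply: rpredZ; apply: memv_line.
by rewrite scalerK.
Qed.

Lemma free_mod4_intro S a b c d :
  (forall x y z t, x *: a + y *: b + z *: c + t *: d \in S ->
    [/\ x = 0, y = 0, z = 0 & t = 0]) -> free_mod S [:: a; b; c; d].
Proof.
move=> h e; rewrite /= !big_ord_recl big_ord0 /= addr0 !addrA.
by move=> /h[e0 e1 e2 e3] [|[|[|[|]]]].
Qed.

Lemma dimv_codim2_line S T : (S <= T)%VS -> \dim T = (\dim S).+2 ->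
  exists a c, [/\ a \notin S, c \notin (S + <[a]>)%VS & T = (S + <[a]> + <[c]>)%VS].
Proof.
move=> ST dT; have [|a aT aS] := @dimv_lt_notin _ _ S T; first by rewrite dT ltnW.
have [||c cS Tc] := @dimv_codim1_line _ _ (S + <[a]>)%VS T.
- by rewrite subv_add_line ST.
- by rewrite dimv_add_line.
by exists a, c.
Qed.

Lemma cap_add_line2 S Z u v : (S <= Z)%VS ->
  \dim (Z :&: (S + <[u]> + <[v]>)) = (\dim S).+1 ->
  exists x y, x *: u + y *: v \in Z /\ x *: u + y *: v \notin S.
Proof.
move=> SZ dZ; have [|w /memv_capP[wZ wX] wS] := @dimv_lt_notin _ _ S (Z :&: (S + <[u]> + <[v]>)).
  by rewrite dZ.
have /memv_add_line2P[x [y h]] := wX; exists x, y.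
have {}h : w - (x *: u + y *: v) \in S by rewrite opprD addrA.
split; first by have := rpredB wZ (subvP SZ _ h); rewrite subKr.
by apply: contra wS => vS; have := rpredD h vS; rewrite subrK.
Qed.

(* [Z] meets the three lines [<a, c>], [<b, d>], [<a + b, c + d>] of one ruling
   (modulo [S]), hence lies in the opposite ruling. *)
Lemma regulus_form S Z a b c d : free_mod S [:: a; b; c; d] -> (S <= Z)%VS ->
  \dim Z = (\dim S).+2 ->
  \dim (Z :&: (S + <[a]> + <[c]>)) = (\dim S).+1 ->
  \dim (Z :&: (S + <[b]> + <[d]>)) = (\dim S).+1 ->
  \dim (Z :&: (S + <[a + b]> + <[c + d]>)) = (\dim S).+1 ->
  exists x y, (x, y) != (0, 0) /\
    Z = (S + <[x *: a + y *: c]> + <[x *: b + y *: d]>)%VS.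
Proof.
move=> /free_mod4 fr SZ dZ.
move=> /(cap_add_line2 SZ)[x1 [y1 [v1Z v1S]]] /(cap_add_line2 SZ)[x2 [y2 [v2Z v2S]]].
move=> /(cap_add_line2 SZ)[x3 [y3 [v3Z v3S]]].
have indep x y z t k : (x *: b + y *: d) - k *: (z *: a + t *: c) \in S ->
    x = 0 /\ y = 0.
  move=> h; have [|_ -> _ -> //] := fr (- (k * z)) x (- (k * t)) y.
  move: h; congr (_ \in S); rewrite scalerDr !scalerA opprD !scaleNr !addrA.
  by rewrite [LHS](ACl (3*1*4*2)).
have indep' x y : x *: a + y *: c \in S -> x = 0 /\ y = 0.
  move=> h; have [|-> _ -> //] := fr x 0 y 0.
  by move: h; rewrite !scale0r !addr0.
have ZE : Z = (S + <[x1 *: a + y1 *: c]> + <[x2 *: b + y2 *: d]>)%VS.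
  apply: eq_add_line2 => //; apply/negP => /memv_add_lineP[k /indep[x20 y20]].
  by move: v2S; rewrite x20 y20 !scale0r addr0 mem0v.
(* Expressing the third vector through the first two modulo [S] and comparing coordinates makes
   [(x3, y3)] equal to [k] times [(x1, y1)] and to [l] times [(x2, y2)]. *)
have := v3Z; rewrite {1}ZE => /memv_add_line2P[k [l h]].
have [E1 E2 E3 E4] : [/\ x3 - k * x1 = 0, x3 - l * x2 = 0, y3 - k * y1 = 0 & y3 - l * y2 = 0].
  apply: fr; move: h; congr (_ \in S).
  rewrite !scalerDr !scalerBl !opprD !scalerA !addrA.
  by rewrite [LHS](ACl (1*5*2*7*3*6*4*8)).
exists x3, y3; have xy : (x3, y3) != (0, 0).
  by apply: contraNneq v3S => -[-> ->]; rewrite !scale0r addr0 mem0v.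
split=> //; apply: eq_add_line2 => //.
- have -> : x3 *: a + y3 *: c = k *: (x1 *: a + y1 *: c).
    by rewrite (subr0_eq E1) (subr0_eq E3) scalerDr !scalerA.
  by rewrite rpredZ.
- have -> : x3 *: b + y3 *: d = l *: (x2 *: b + y2 *: d).
    by rewrite (subr0_eq E2) (subr0_eq E4) scalerDr !scalerA.
  by rewrite rpredZ.
- by apply: contra xy => /indep'[-> ->].
by apply/negP => /memv_add_lineP[m /indep[x0 y0]]; move: xy; rewrite x0 y0 eqxx.
Qed.

(** The vector of [Z] in the span of [a] and [c] fixes the parameters of [Z] up to a nonzero factor
    [k]. *)
Lemma regulus_line S Z a b c d x y x0 y0 : free_mod S [:: a; b; c; d] ->
  (x0, y0) != (0, 0) -> x0 *: a + y0 *: c \in Z ->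
  Z = (S + <[x *: a + y *: c]> + <[x *: b + y *: d]>)%VS ->
  Z = (S + <[x0 *: a + y0 *: c]> + <[x0 *: b + y0 *: d]>)%VS.
Proof.
move=> /free_mod4 fr xy0 vZ ZE.
have := vZ; rewrite {1}ZE => /memv_add_line2P[k [l h]].
have [E1 _ E3 _] : [/\ x0 - k * x = 0, - (l * x) = 0, y0 - k * y = 0 & - (l * y) = 0].
  apply: fr; move: h; congr (_ \in S).
  rewrite !scalerDr !scalerBl !opprD !scalerA !scaleNr !addrA.
  by rewrite [LHS](ACl (1*3*5*2*4*6)).
have k0 : k != 0.
  by apply: contraNneq xy0 => k0; rewrite (subr0_eq E1) (subr0_eq E3) k0 !mul0r.
by rewrite ZE (subr0_eq E1) (subr0_eq E3) -!scalerA -!scalerDr !lineZ.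
Qed.
End Regulus.

Section CaseC.
Variables (K : finFieldType) (N : nat).
Local Notation vT := 'rV[K]_N.
Local Notation q := #|K|.
Implicit Types (U V : 'I_q.+1 -> {vspace vT}).

(** Sum the equation over the vectors of [X]; in dimension [n] the weights are indicators. *)
Lemma sum_card_cap n U V (X : {vspace vT}) : weight_eq n U V ->
  (forall i, \dim (U i) = n) -> (forall i, \dim (V i) = n) ->
  (\sum_i q ^ \dim (V i :&: X) = \sum_i q ^ \dim (U i :&: X))%N.
Proof.
move=> UV dU dV.
have E (T : 'I_q.+1 -> {vspace vT}) : (forall i, \dim (T i) = n) ->
    (\sum_i q ^ \dim (T i :&: X) = \sum_(w | w \in X) \sum_i weight n (T i) w)%N.
  move=> dT; rewrite exchange_big; apply: eq_bigr => i _.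
  rewrite -card_vspace_rV -sum1_card big_mkcond [RHS]big_mkcond /=.
  apply: eq_bigr => w _; rewrite inE memv_cap weight_top // andbC.
  by case: (w \in X) => //=; case: (w \in T i).
by rewrite !E //; apply: eq_bigr => w _; rewrite UV.
Qed.

(** Take [X = U j] in [sum_card_cap]. Every [V k :&: U j] has dimension [n - 1], so the [q]
    intersections of [U j] with the other [U k] have sizes adding up to [q ^ (n - 1)]. Each contains
    the axis of the pencil on [V i], of size [q ^ (n - 2)], so equality holds throughout. *)
Lemma all_top_cap n U V : reduced n U V ->
  (forall j, \dim (U j) = n) -> (forall i, \dim (V i) = n) ->
  forall i j, i != j -> (\dim (U i :&: U j)).+2 = n.
Proof.
move=> red dU dV i j ij; have [UV _ _ _] := red.
have [m nE] : exists m, n = m.+2.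
  by exists (\dim (U i :&: V i :&: (U j :&: V i))); rewrite (top_cap_dim red (dV i)).
have qm : (0 < q ^ m)%N by rewrite expn_gt0 (ltnW (card_finField_gt1 K)).
have := sum_card_cap (U j) UV dU dV.
have -> : (\sum_i q ^ \dim (V i :&: U j) = \sum_(i < q.+1) q ^ m.+1)%N.
  apply: eq_bigr => k _; congr (_ ^ _)%N; apply/eqP.
  by rewrite -eqSS -nE capvC (top_dim red (dV k)).
rewrite sum_nat_const card_ord mulSn -expnS -nE (bigD1 j) //= capvv dU addnC.
move/addnI => E; apply/eqP; rewrite nE !eqSS eq_sym.
rewrite -(eqn_exp2l _ _ (card_finField_gt1 K)); apply/eqP.
apply: (@leq_sum_eq _ (fun k => k != j) (fun=> q ^ m)%N
  (fun k => q ^ \dim (U k :&: U j))%N) => // [k kj|].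
  rewrite leq_exp2l ?card_finField_gt1 // -2!ltnS -nE -(top_cap_dim red (dV i) kj) !ltnS.
  by apply: dimvS; apply: capvS; apply: capvSl.
by rewrite sum_nat_but1 -expnS -E.
Qed.

(** By dimension, [U i :&: U j] is the axis of the pencil on each [V k], hence lies in every [V k]
    and every [U l]. *)
Lemma all_top_common n U V : reduced n U V ->
  (forall j, \dim (U j) = n) -> (forall i, \dim (V i) = n) ->
  exists S : {vspace vT}, [/\ (\dim S).+2 = n,
    forall i j, i != j -> (U i :&: U j)%VS = S &
    forall i j, i != j -> (V i :&: V j)%VS = S].
Proof.
move=> red dU dV; have red' := reduced_sym red.
have dUU := all_top_cap red dU dV; have dVV := all_top_cap red' dV dU.
have capE i j k : i != j -> (U i :&: V k :&: (U j :&: V k) = U i :&: U j)%VS.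
  move=> ij; apply: subv_dim_eq; first by apply: capvS; apply: capvSl.
  by apply/eqP; rewrite -2!eqSS dUU // (top_cap_dim red (dV k)).
have [j1 j01] := ord_neq_exists (@ord0 q).
pose S := (U ord0 :&: U j1)%VS.
have dS : (\dim S).+2 = n by apply: dUU.
have SU l : (S <= U l)%VS.
  by rewrite /S -(capE _ _ ord0) // (top_cap_sub red (dV ord0)).
have SV k : (S <= V k)%VS.
  by rewrite /S -(capE _ _ k) // (subv_trans (capvSl _ _)) ?capvSr.
exists S; split=> // i j ij; apply/esym/subv_dim_eq; rewrite ?subv_cap ?SU ?SV //;
  apply/eqP; rewrite -2!eqSS dS; [rewrite dUU|rewrite dVV] => //.
Qed.

(** Modulo [S], a basis is chosen in which three of the [V i] are the spans of [a, c], of [b, d] and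
    of [a + b, c + d]. Then [regulus_form] puts every [U j] in the opposite ruling, and three of the
    [U j] put every [V i] in the first. *)
Lemma caseC n U V : reduced n U V ->
  (forall j, \dim (U j) = n) -> (forall i, \dim (V i) = n) ->
  exists S a b c d, [/\ free_mod S [:: a; b; c; d],
    forall i, exists x y : K, (x, y) != (0, 0) /\
      V i = (S + <[x *: a + y *: b]> + <[x *: c + y *: d]>)%VS &
    forall j, exists x y : K, (x, y) != (0, 0) /\
      U j = (S + <[x *: a + y *: c]> + <[x *: b + y *: d]>)%VS].
Proof.
move=> red dU dV; have red' := reduced_sym red; have [UV _ _ _] := red.
have [S [dS UUS VVS]] := all_top_common red dU dV.
have SU j : (S <= U j)%VS.
  by have [k jk] := ord_neq_exists j; rewrite -(UUS _ _ jk) capvSl.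
have SV j : (S <= V j)%VS.
  by have [k jk] := ord_neq_exists j; rewrite -(VVS _ _ jk) capvSl.
have dUV i j : \dim (U j :&: V i) = (\dim S).+1.
  by apply/eqP; rewrite -eqSS dS (top_dim red (dV i)).
have UVV j i k : i != k -> (U j <= V i + V k)%VS.
  move=> ik; suff <- : (V i :&: U j + V k :&: U j)%VS = U j.
    by apply: addvS; apply: capvSl.
  apply: subv_dim_eq; first by rewrite subv_add !capvSr.
  have := dimv_sum_cap (V i :&: U j) (V k :&: U j).
  have := top_cap_dim red' (dU j) ik; rewrite !(capvC _ (U j)) !dUV dU -dS.
  by move=> -[->]; lia.
have VVV l i k : i != k -> (V l <= V i + V k)%VS.
  move=> ik; have [j j0] := ord_neq_exists (@ord0 q).
  suff : (V l <= U ord0 + U j)%VS.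
    by move/subv_trans; apply; rewrite subv_add !UVV.
  suff <- : (U ord0 :&: V l + U j :&: V l)%VS = V l.
    by apply: addvS; apply: capvSl.
  apply: subv_dim_eq; first by rewrite subv_add !capvSr.
  have := dimv_sum_cap (U ord0 :&: V l) (U j :&: V l).
  by have := top_cap_dim red (dV l) j0; rewrite !dUV dV -dS => -[->]; lia.
pose i1 := @ord0 q; have [i2 [i21 _]] := ord_neq2_exists i1 i1.
have [i3 [i31 i32]] := ord_neq2_exists i1 i2.
have [a [c [aS cSa V1E]]] : exists a c, [/\ a \notin S, c \notin (S + <[a]>)%VS &
    V i1 = (S + <[a]> + <[c]>)%VS].
  by apply: dimv_codim2_line; rewrite ?SV // dV.
have aV : a \in V i1.
  rewrite V1E; apply/memv_add_line2P; exists 1, 0.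
  by rewrite scale1r subrr scale0r subr0 mem0v.
have cV : c \in V i1.
  rewrite V1E; apply/memv_add_line2P; exists 0, 1.
  by rewrite scale1r scale0r subr0 subrr mem0v.
(* Split [v] along [V i3 + V i2] and negate the component in [V i2]. *)
have opp v : v \in V i1 -> exists2 v', v' \in V i2 & v + v' \in V i3.
  move=> /(subvP (VVV i1 _ _ i32)) /memv_addP[v3 v3V [v2 v2V ->]].
  by exists (- v2); rewrite ?rpredN // addrK.
have [b bV abV] := opp a aV; have [d dV2 cdV] := opp c cV.
have inS i j w : i != j -> w \in V i -> w \in V j -> w \in S.
  by move=> ij wi wj; rewrite -(VVS _ _ ij) memv_cap wi.
have fr2 : free_mod S [:: a; c].
  by apply: free_mod_cons => //; apply: free_mod_cons => //; apply: free_mod0.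
(* The part in [a, c] lies in [V i1] and, modulo [S], in [V i2], hence in [S]. Replacing [b, d] by
   [a + b, c + d] then brings [y *: a + t *: c] into [V i3]. *)
have fr4 x y z t : x *: a + y *: b + z *: c + t *: d \in S ->
    [/\ x = 0, y = 0, z = 0 & t = 0].
  move=> h; have hac : x *: a + z *: c \in S.
    apply: (inS i1 i2); first by rewrite eq_sym.
      by rewrite rpredD ?rpredZ.
    have := rpredB (subvP (SV i2) _ h) (rpredD (rpredZ y bV) (rpredZ t dV2)).
    congr (_ \in V i2); rewrite opprD !addrA.
    by rewrite [LHS](ACl (1*3*(2*5)*(4*6))) /= !subrr !addr0.
  have [x0 z0] := free_mod2 fr2 hac.
  move: h; rewrite x0 z0 !scale0r add0r addr0 => h.
  have [|-> -> //] := free_mod2 fr2 (_ : y *: a + t *: c \in S).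
  apply: (inS i1 i3); first by rewrite eq_sym.
    by rewrite rpredD ?rpredZ.
  have := rpredB (rpredD (rpredZ y abV) (rpredZ t cdV)) (subvP (SV i3) _ h).
  congr (_ \in V i3); rewrite !scalerDr opprD !addrA.
  by rewrite [LHS](ACl (1*3*(2*5)*(4*6))) /= !subrr !addr0.
have frabcd : free_mod S [:: a; b; c; d] by apply: free_mod4_intro.
have fracbd : free_mod S [:: a; c; b; d].
  apply: free_mod4_intro => x y z t; rewrite [X in X + _ \in _]addrAC.
  by move=> /fr4[-> -> -> ->].
have V2E : V i2 = (S + <[b]> + <[d]>)%VS.
  apply: eq_add_line2; rewrite ?dV ?SV //.
    apply/negP => bS; have [|_ /eqP] := fr4 0 1 0 0; rewrite ?oner_eq0 //.
    by rewrite !scale0r scale1r add0r !addr0.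
  apply/negP => /memv_add_lineP[x h]; have [|_ _ _ /eqP] := fr4 0 (- x) 0 1; rewrite ?oner_eq0 //.
  by rewrite !scale0r scale1r add0r !addr0 addrC scaleNr.
have V3E : V i3 = (S + <[a + b]> + <[c + d]>)%VS.
  apply: eq_add_line2; rewrite ?dV ?SV //.
    apply/negP => bS; have [|_ /eqP] := fr4 1 1 0 0; rewrite ?oner_eq0 //.
    by rewrite !scale0r !scale1r !addr0.
  apply/negP => /memv_add_lineP[x h].
  have [|_ _ _ /eqP] := fr4 (- x) (- x) 1 1; rewrite ?oner_eq0 //.
  by rewrite !scale1r -scalerDr -addrA addrC scaleNr.
have UE j : exists x y : K, (x, y) != (0, 0) /\
      U j = (S + <[x *: a + y *: c]> + <[x *: b + y *: d]>)%VS.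
  by apply: regulus_form; rewrite ?dU -?V1E -?V2E -?V3E ?dUV.
(* Some [U j] passes through each vector of [V i1], so every parameter occurs. *)
have Uline x0 y0 : (x0, y0) != (0, 0) :> K * K ->
    exists j, U j = (S + <[x0 *: a + y0 *: c]> + <[x0 *: b + y0 *: d]>)%VS.
  move=> xy0; have vV : x0 *: a + y0 *: c \in V i1 by rewrite rpredD ?rpredZ.
  have [j vU] := weight_eq_cover UV vV; exists j.
  have [x [y [_ Uj]]] := UE j.
  exact: regulus_line frabcd xy0 vU Uj.
exists S, a, b, c, d; split=> // i.
(* These three parameters give members of [U] spanned modulo [S] by [a, b], by [c, d] and by
   [a + c, b + d]: the situation of [regulus_form] with [b] and [c] exchanged. *)
have n10 : (1, 0) != (0, 0) :> K * K by apply/eqP => -[/eqP]; rewrite oner_eq0.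
have n01 : (0, 1) != (0, 0) :> K * K by apply/eqP => -[/eqP]; rewrite oner_eq0.
have n11 : (1, 1) != (0, 0) :> K * K by apply/eqP => -[/eqP]; rewrite oner_eq0.
have [ja Ua] := Uline _ _ n10; have [jc Uc] := Uline _ _ n01.
have [je Ue] := Uline _ _ n11.
move: Ua Uc Ue; rewrite !scale1r !scale0r !addr0 !add0r => Ua Uc Ue.
by apply: regulus_form; rewrite ?dV -?Ua -?Uc -?Ue // capvC dUV.
Qed.
End CaseC.

(** * Transfer to W *)

Section Span.
Variables (K : fieldType) (W : lmodType K).
Implicit Types (A X : set W).

Lemma is_subspaceP A :
  is_subspace A <-> A 0 /\ forall k u v, A u -> A v -> A (k *: u + v).
Proof.
split=> -[A0 Al]; split; first by move: A0; rewrite in_setE.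
- by move=> k u v /mem_set Au /mem_set Av; apply: set_mem; apply: Al.
- by rewrite in_setE.
by move=> k u v; rewrite !in_setE; apply: Al.
Qed.

Lemma is_subspaceZ A k u : is_subspace A -> A u -> A (k *: u).
Proof. by move=> /is_subspaceP[A0 Al] Au; rewrite -[_ *: _]addr0; apply: Al. Qed.

Lemma is_subspaceD A u v : is_subspace A -> A u -> A v -> A (u + v).
Proof.
by move=> /is_subspaceP[A0 Al] Au Av; rewrite -[u]scale1r; apply: Al.
Qed.

Lemma is_subspace_sum A (I : finType) (c : I -> K) (u : I -> W) :
  is_subspace A -> (forall i, A (u i)) -> A (\sum_i c i *: u i).
Proof.
move=> sA Au; elim/big_ind: _ => [|x y|i _].
- by case/is_subspaceP: sA.
- exact: is_subspaceD.
exact: is_subspaceZ.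
Qed.

Lemma is_subspace_lspan X : is_subspace (lspan X).
Proof.
apply/is_subspaceP; split=> [A [/is_subspaceP[A0 _] _] //|k u v uX vX A AX].
by have [/is_subspaceP[_ Al] _] := AX; apply: Al; [apply: uX|apply: vX].
Qed.

Lemma sub_lspan X : X `<=` lspan X.
Proof. exact: sub_gen_smallest. Qed.

Lemma lspan_sub X A : is_subspace A -> X `<=` A -> lspan X `<=` A.
Proof. exact: smallest_sub. Qed.
End Span.

Lemma vspace_of_set (K : finFieldType) N (A : set 'rV[K]_N) : is_subspace A ->
  exists V : {vspace 'rV[K]_N}, A = [set` V].
Proof.
move=> sA; pose X := in_tuple [seq v <- enum 'rV[K]_N | `[< A v >]].
exists <<X>>%VS; apply/seteqP; split=> v => [Av|vX].
  by apply: memv_span; rewrite mem_filter mem_enum andbT; apply/asboolP.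
rewrite (@coord_span _ _ _ X v vX); apply: is_subspace_sum => // i.
have : X`_i \in X by apply: mem_nth.
by rewrite mem_filter => /andP[/asboolP].
Qed.

Section LinComb.
Variables (K : fieldType) (W : lmodType K) (n : nat) (s : 'I_n -> W).

Definition lincomb (v : 'rV[K]_n) : W := \sum_i v 0 i *: s i.

Fact lincomb_linear : linear lincomb.
Proof.
move=> k u v; rewrite /lincomb scaler_sumr -big_split; apply: eq_bigr => i _ /=.
by rewrite !mxE scalerDl scalerA.
Qed.

HB.instance Definition _ := GRing.isLinear.Build K 'rV[K]_n W *:%R lincomb lincomb_linear.
End LinComb.

Section Image.
Variables (K : fieldType) (vT : vectType K) (W : lmodType K) (f : {linear vT -> W}).
Hypothesis finj : injective f.
Implicit Types (S : {vspace vT}) (s : seq vT).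

Definition im S : set W := f @` [set` S].

Lemma im_subspace S : is_subspace (im S).
Proof.
apply/is_subspaceP; split; first by exists 0; rewrite /= ?mem0v ?linear0.
move=> k _ _ [u uS <-] [v vS <-]; exists (k *: u + v); last exact: linearP.
by rewrite /= rpredD ?rpredZ.
Qed.

Lemma im_memE S v : im S (f v) <-> v \in S.
Proof. by split=> [[u uS /finj <-]|vS] //; exists v. Qed.

Lemma lspan_line S a : lspan (im S `|` [set f a]) = im (S + <[a]>).
Proof.
apply/seteqP; split=> [|_ [_ /memv_addP[u uS [_ /vlineP[x ->] ->]] <-]].
  apply: lspan_sub; first exact: im_subspace.
  move=> _ [[u uS <-]|->]; apply/im_memE.
    exact: (subvP (addvSl _ _)).
  by rewrite (subvP (addvSr _ _)) ?memv_line.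
rewrite linearD linearZ /=; apply: (is_subspaceD (is_subspace_lspan _)).
  by apply: sub_lspan; left; exists u.
by apply: (is_subspaceZ _ (is_subspace_lspan _)); apply: sub_lspan; right.
Qed.

Lemma lspan_line2 S a b : lspan (im S `|` [set f a; f b]) = im (S + <[a]> + <[b]>).
Proof.
rewrite -lspan_line -lspan_line; apply/seteqP; split.
  apply: lspan_sub; first exact: is_subspace_lspan.
  move=> w [wS|[->|->]]; apply: sub_lspan; [left|left|by right].
    by apply: sub_lspan; left.
  by apply: sub_lspan; right.
apply: lspan_sub; first exact: is_subspace_lspan.
move=> w [|->]; last by apply: sub_lspan; right; right.
move: w; apply: lspan_sub; first exact: is_subspace_lspan.
by move=> w [wS|->]; apply: sub_lspan; [left|right; left].
Qed.

Lemma lspan_seq s : lspan [set` map f s] = im <<s>>.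
Proof.
apply/seteqP; split=> [|_ [v vs <-]].
  apply: lspan_sub; first exact: im_subspace.
  by move=> _ /mapP[v vs ->]; apply/im_memE/memv_span.
rewrite (@coord_span _ _ _ (in_tuple s) v vs).
rewrite linear_sum /=; under eq_bigr do rewrite linearZ.
apply: (is_subspace_sum _ (is_subspace_lspan _)) => i.
by apply: sub_lspan; apply: map_f; apply: mem_nth.
Qed.

Lemma free_mod_lin_indep S s : free_mod S s -> lin_indep (map f s).
Proof.
move=> fr; rewrite /lin_indep size_map => c c0 i.
(* Coefficients on ['I_(size s)] are extended by 0 to [nat], as [free_mod] requires. *)
pose c' k := if insub k is Some j then c j else 0.
have c'E (j : 'I_(size s)) : c' j = c j by rewrite /c' valK.
rewrite -c'E; apply: fr (ltn_ord i).
suff -> : \sum_(j < size s) c' j *: s`_j = 0 by apply: mem0v.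
apply: finj; rewrite linear0 -[RHS]c0 linear_sum; apply: eq_bigr => j _ /=.
by rewrite linearZ /= c'E (nth_map 0).
Qed.

Lemma free_mod_cap S s : free_mod S s -> im S `&` lspan [set` map f s] = [set 0].
Proof.
move=> fr; rewrite lspan_seq; apply/seteqP; split=> [w [[v vS <-]]|_ ->].
  move/im_memE => vs; have vE := @coord_span _ _ _ (in_tuple s) v vs.
  pose c' k := if insub k is Some j then coord (in_tuple s) j v else 0.
  have c'E (j : 'I_(size s)) : c' j = coord (in_tuple s) j v by rewrite /c' valK.
  have vE' : v = \sum_(j < size s) c' j *: s`_j.
    by rewrite {1}vE; apply: eq_bigr => j _; rewrite c'E.
  move: vS; rewrite /= vE' => /fr c0.
  by rewrite big1 ?linear0 // => j _; rewrite c0 ?scale0r.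
by split; exists 0; rewrite /= ?mem0v ?linear0.
Qed.
End Image.

(** * Tuples up to permutation *)

Section TupleEquiv.
Variables (m : nat) (T : Type).
Implicit Types (A B : 'I_m -> T).

(** The chosen index map is injective because [A] is, hence a permutation of a finite set. Thus a
    form found for each member separately already matches the whole enumeration. *)
Lemma inj_tuple_equiv A B :
  injective A -> (forall i, exists k, A i = B k) -> tuple_equiv A B.
Proof.
move=> injA /choice[k kE].
have kinj : injective k by move=> i j ij; apply: injA; rewrite !kE ij.
by exists (perm kinj)^-1%g => i; rewrite kE -(permE kinj) permKV.
Qed.

Lemma perm_tuple_equiv A (p : 'S_m) : tuple_equiv A (A \o p).
Proof. by exists p. Qed.

Lemma pair_equiv_swap A B A' B' : pair_equiv A B A' B' -> pair_equiv B A A' B'.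
Proof. by case=> h; [right|left]. Qed.
End TupleEquiv.

Lemma tuple_equiv_comp m (T T' : Type) (g : T -> T') (A B : 'I_m -> T) :
  tuple_equiv A B -> tuple_equiv (g \o A) (g \o B).
Proof. by case=> p pE; exists p => i /=; rewrite pE. Qed.

Lemma perm_eq_tuple_equiv m (T : eqType) (A B : 'I_m -> T) :
  perm_eq (codom A) (codom B) -> tuple_equiv A B.
Proof.
rewrite perm_sym => pBA.
have : perm_eq (map_tuple B (ord_tuple m)) (map_tuple A (ord_tuple m)).
  exact: pBA.
case/tuple_permP => p /val_inj pE; exists p => i.
by have := congr1 (fun t => tnth t i) pE; rewrite tnth_mktuple !tnth_map !tnth_ord_tuple.
Qed.

Section Enumeration.
Variables (K : fieldType) (vT : vectType K) (n : nat) (alpha beta : 'I_n -> K).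
Hypothesis enum_P1 : P1_enum alpha beta.

(** The index is chosen before [a] and [b], since Type C needs the same one for two pairs of
    vectors. *)
Lemma P1_line (x y : K) : (x, y) != (0, 0) ->
  exists i, forall (a b : vT),
    (<[x *: a + y *: b]> = <[alpha i *: a + beta i *: b]>)%VS.
Proof.
move=> /(proj2 enum_P1)[i [[l [l0 [-> ->]]] _]]; exists i => a b.
by rewrite -!scalerA -scalerDr lineZ.
Qed.
End Enumeration.

Lemma init_ordE q (i : 'I_q) : init_ord i = lift ord_max i.
Proof. by apply/val_inj/esym/lift_max. Qed.

(** * Classification in a coordinate space *)

Section Assembly.
Variables (K : finFieldType) (N : nat) (W : lmodType K).
Variable f : {linear 'rV[K]_N -> W}.
Hypothesis finj : injective f.
Local Notation vT := 'rV[K]_N.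
Local Notation q := #|K|.
Variables (alpha beta : 'I_q.+1 -> K) (gamma : 'I_q -> K).
Hypothesis enum_P1 : P1_enum alpha beta.
Hypothesis enum_K : bijective gamma.
Implicit Types (U V : 'I_q.+1 -> {vspace vT}).

Definition classified U V := exists U' V' : 'I_q.+1 -> set W,
  pair_equiv (im f \o U) (im f \o V) U' V' /\
  (typeA alpha beta U' V' \/ typeB gamma U' V' \/ typeC alpha beta U' V').

Lemma classified_swap U V : classified U V -> classified V U.
Proof.
by move=> [U' [V' [/pair_equiv_swap UV t]]]; exists U', V'.
Qed.

Lemma classified_of U V U' V' : tuple_equiv U U' -> tuple_equiv V V' ->
  typeA alpha beta (im f \o U') (im f \o V') \/ typeB gamma (im f \o U') (im f \o V') \/
    typeC alpha beta (im f \o U') (im f \o V') ->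
  classified U V.
Proof.
move=> UU VV t; exists (im f \o U'), (im f \o V'); split=> //.
by left; split; apply: tuple_equiv_comp.
Qed.

Lemma reduced_typeA n U V i0 : reduced n U V -> \dim (V i0) = n ->
  (forall j, \dim (U j) != n) -> classified U V.
Proof.
move=> red dV dU; have [S [a [b [i1 [fr Vi1 VE UE]]]]] := caseA red dV dU.
(* The transposition moves the exceptional index [i1] to the last place. *)
apply: (@classified_of _ _ (fun k => S + <[alpha k *: a + beta k *: b]>)%VS
  (V \o tperm i1 ord_max)).
- apply: inj_tuple_equiv; first exact: top_inj red dV.
  move=> j; have [x [y [xy ->]]] := UE j; have [k kE] := P1_line vT enum_P1 xy.
  by exists k; rewrite kE.
- exact: perm_tuple_equiv.
left; exists (im f S), (f a), (f b).
have := free_mod_cap finj fr; have := free_mod_lin_indep finj fr; rewrite /= => li.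
have -> : [set` [:: f a; f b]] = [set f a; f b].
  apply/seteqP; split=> w; rewrite /= !inE.
    by move=> /orP[]/eqP->; [left|right].
  by move=> [|] ->; rewrite eqxx ?orbT.
move=> cap0; split=> //; first exact: im_subspace; split=> [i||i] /=.
- rewrite lspan_line2 // VE // -(inj_eq (@perm_inj _ (tperm i1 ord_max))).
  by rewrite tpermK tpermL init_ordE eq_sym neq_lift.
- by rewrite tpermR Vi1.
by rewrite -(lspan_line finj) linearD !linearZ.
Qed.

Lemma reduced_typeB n U V i0 j0 i1 : reduced n U V -> \dim (V i0) = n ->
  \dim (U j0) = n -> \dim (V i1) != n -> classified U V.
Proof.
move=> red dV dU dV1; have red' := reduced_sym red.
have [S [a [b [c [j1 [fr Vi1 Uj1 VE UE]]]]]] := caseB red dV dU dV1.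
have [g gK Kg] := enum_K.
(* The exceptional member takes the last place; the others follow the enumeration [gamma]. *)
pose T (u v : vT) k := if unlift ord_max k is Some i then
  (S + <[v]> + <[(gamma i *: u + c)%R]>)%VS else (S + <[u]>)%VS.
have TE (X : 'I_q.+1 -> {vspace vT}) u v k1 : injective X -> X k1 = (S + <[u]>)%VS ->
    (forall k, k != k1 -> exists x, X k = (S + <[v]> + <[x *: u + c]>)%VS) ->
    tuple_equiv X (T u v).
  move=> Xinj Xk1 XE; apply: inj_tuple_equiv => // k.
  case: (eqVneq k k1) => [->|/XE[x ->]]; first by exists ord_max; rewrite /T unlift_none.
  by exists (lift ord_max (g x)); rewrite /T liftK Kg.
apply: (@classified_of _ _ (T b a) (T a b)).
- exact: TE (top_inj red dV) Uj1 UE.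
- exact: TE (top_inj red' dU) Vi1 VE.
right; left; exists (im f S), (f a), (f b), (f c).
have := free_mod_cap finj fr; have := free_mod_lin_indep finj fr; rewrite /= => li.
have -> : [set` [:: f a; f b; f c]] = [set f a; f b; f c].
  apply/seteqP; split=> w; rewrite /= !inE.
    by move=> /or3P[]/eqP->; [left; left|left; right|right].
  by move=> [[|]|] ->; rewrite eqxx ?orbT.
move=> cap0; split=> //; first exact: im_subspace.
split=> [||i|i] /=; rewrite /T ?unlift_none ?init_ordE ?liftK ?lspan_line //.
  by rewrite -(lspan_line2 finj) linearD linearZ.
by rewrite -(lspan_line2 finj) linearD linearZ.
Qed.

Lemma reduced_typeC n U V : reduced n U V ->
  (forall j, \dim (U j) = n) -> (forall i, \dim (V i) = n) -> classified U V.
Proof.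
move=> red dU dV; have red' := reduced_sym red.
have [S [a [b [c [d [fr VE UE]]]]]] := caseC red dU dV.
pose T (u v w x : vT) k := (S + <[(alpha k *: u + beta k *: v)%R]>
  + <[(alpha k *: w + beta k *: x)%R]>)%VS.
have TE (X : 'I_q.+1 -> {vspace vT}) u v w x : injective X ->
    (forall k, exists y z : K, (y, z) != (0, 0) /\
      X k = (S + <[y *: u + z *: v]> + <[y *: w + z *: x]>)%VS) ->
    tuple_equiv X (T u v w x).
  move=> Xinj XE; apply: inj_tuple_equiv => // k; have [y [z [yz ->]]] := XE k.
  by have [l lE] := P1_line vT enum_P1 yz; exists l; rewrite /T !lE.
apply: (@classified_of _ _ (T a c b d) (T a b c d)).
- exact: TE (top_inj red (dV ord0)) UE.
- exact: TE (top_inj red' (dU ord0)) VE.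
right; right; exists (im f S), (f a), (f b), (f c), (f d).
have := free_mod_cap finj fr; have := free_mod_lin_indep finj fr; rewrite /= => li.
have -> : [set` [:: f a; f b; f c; f d]] = [set f a; f b; f c; f d].
  apply/seteqP; split=> w; rewrite /= !inE.
    by move=> /or4P[]/eqP->; [left; left; left|left; left; right|left; right|right].
  by move=> [[[|]|]|] ->; rewrite eqxx ?orbT.
move=> cap0; split=> //; first exact: im_subspace.
by move=> i; rewrite /= /T -!lspan_line2 // !linearD !linearZ.
Qed.

Lemma reduced_top n U V i0 : reduced n U V -> \dim (V i0) = n -> classified U V.
Proof.
move=> red dV; have red' := reduced_sym red.
case: (pselect (exists j0, \dim (U j0) = n)) => [[j0 dU]|noj]; last first.
  by apply: reduced_typeA red dV _ => j; apply/eqP => dj; apply: noj; exists j.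
case: (pselect (exists i1, \dim (V i1) != n)) => [[i1]|noi].
  exact: reduced_typeB red dV dU.
have {}dV i : \dim (V i) = n by apply/eqP/negPn/negP => h; apply: noi; exists i.
(* A low [U j] would force a low [V i], by [low_exists] with the tuples exchanged. *)
apply: (reduced_typeC red _ dV) => j; apply/eqP/negPn/negP => dj.
by have [i] := low_exists red' (top_dimE red (dV ord0) dj); rewrite dV eqxx.
Qed.

Lemma weighted_eq_classified U V :
  weighted_eq U V -> ~ tuple_equiv U V -> classified U V.
Proof.
move=> UV nUV.
(* Being a maximum, [n] is attained in one of the tuples; by symmetry this may be [V]. *)
pose n := (\max_i maxn (\dim (U i)) (\dim (V i)))%N.
have dUV i : (maxn (\dim (U i)) (\dim (V i)) <= n)%N.
  exact: (leq_bigmax (F := fun i => maxn (\dim (U i)) (\dim (V i)))).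
have dU i : (\dim (U i) <= n)%N by apply: leq_trans (dUV i); apply: leq_maxl.
have dV i : (\dim (V i) <= n)%N by apply: leq_trans (dUV i); apply: leq_maxr.
have UVn := weighted_eq_nat dU dV UV.
have nperm : ~~ perm_eq (codom U) (codom V).
  by apply/negP => /perm_eq_tuple_equiv.
have red : reduced n U V by split=> //; apply: nontrivial_disjoint UVn nperm.
have [i nE] : {i | n = maxn (\dim (U i)) (\dim (V i))}.
  by apply: bigop.eq_bigmax; rewrite card_ord.
case: (leqP (\dim (U i)) (\dim (V i))) nE => _ nE.
  exact: reduced_top red (esym nE).
exact/classified_swap/(reduced_top (reduced_sym red) (esym nE)).
Qed.
End Assembly.

(** * Coordinates for finitely many subspaces of [W] *)

Lemma finite_fin_dim_cover (K : fieldType) (W : lmodType K) (I : finType) (A : I -> set W) :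
  (forall i, fin_dim (A i)) ->
  exists n (s : 'I_n -> W), forall i w, A i w -> exists v, lincomb s v = w.
Proof.
move=> Afin.
have /choice[s sE] : forall i, exists s : seq W, A i = lspan [set` s].
  by move=> i; have [X [/finite_seqP[s ->] ->]] := Afin i; exists s.
(* Concatenated generators put every [A i] in the image of a single [lincomb]. *)
pose t := flatten [seq s i | i <- enum I]; exists (size t), (fun k => t`_k) => i.
rewrite sE; apply: lspan_sub => [|w /= ws].
  apply/is_subspaceP; split; first by exists 0; apply: linear0.
  by move=> k _ _ [u <-] [v <-]; exists (k *: u + v); apply: linearP.
have wt : w \in t by apply/flattenP; exists (s i); rewrite // map_f // mem_enum.
have lt_t : (index w t < size t)%N by rewrite index_mem.
exists (delta_mx 0 (Ordinal lt_t)); rewrite /lincomb (bigD1 (Ordinal lt_t)) //= big1.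
  by rewrite addr0 mxE !eqxx scale1r nth_index.
by move=> k kt; rewrite mxE (negPf kt) andbF scale0r.
Qed.

Lemma card_im (K : finFieldType) N (W : lmodType K) (f : {linear 'rV[K]_N -> W})
  (X : {vspace 'rV[K]_N}) : injective f -> card_set (im f X) = (#|K| ^ \dim X)%N.
Proof.
move=> finj; rewrite -card_vspace_rV /card_set.
have -> : im f X = [set` [fset f v | v in [pred v : 'rV[K]_N | v \in X]]%fset].
  apply/seteqP; split=> [_ [v vX <-]|w /imfsetP[v /= vX ->]]; last by exists v.
  by apply/imfsetP; exists v.
by rewrite set_fsetK card_imfset //= cardE.
Qed.

(** The family [s] may be dependent; restricting [lincomb s] to a complement of its kernel keeps the
    image and gives injectivity. *)
Lemma lincomb_injective (K : finFieldType) (W : lmodType K) n (s : 'I_n -> W) :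
  exists m (f : {linear 'rV[K]_m -> W}),
    injective f /\ forall v, exists u, f u = lincomb s v.
Proof.
have [ker kerE] : exists ker : {vspace 'rV[K]_n}, [set v | lincomb s v = 0] = [set` ker].
  apply: vspace_of_set; apply/is_subspaceP; split; first exact: linear0.
  move=> k u v u0 v0; rewrite /= linearP /=; have -> : lincomb s u = 0 by [].
  by rewrite scaler0 add0r.
have kerP v : v \in ker <-> lincomb s v = 0.
  by rewrite -[lincomb s v = 0]/([set v | lincomb s v = 0] v) kerE.
pose b := vbasis ker^C; pose g := lincomb (fun k : 'I_(\dim ker^C) => b`_k).
exists (\dim ker^C), (lincomb s \o g); split.
  move=> u v /= /eqP; rewrite -subr_eq0 -!linearB => /eqP/kerP gk.
  apply/eqP; rewrite -subr_eq0; apply/eqP; move: (u - v) gk => w gk.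
  have : g w \in (ker :&: ker^C)%VS.
    rewrite memv_cap gk; apply: rpred_sum => k _; apply: rpredZ.
    by apply: vbasis_mem; apply: mem_nth; rewrite size_tuple.
  rewrite capv_compl memv0 => /eqP gw; apply/rowP => k; rewrite mxE.
  have /freeP fr : free b by apply: basis_free (vbasisP _).
  exact: fr gw k.
move=> v; have : v \in (ker + ker^C)%VS by rewrite addv_complf memvf.
move=> /memv_addP[k /kerP k0 [c cC ->]]; exists (\row_i coord b i c).
rewrite linearD /= k0 add0r {2}(coord_vbasis cC); congr (lincomb s _).
by apply: eq_bigr => i _; rewrite mxE.
Qed.

Theorem theorem1 (K : finFieldType) (W : lmodType K) (q : nat)
    (alpha beta : 'I_q.+1 -> K) (gamma : 'I_q -> K)
    (U V : 'I_q.+1 -> set W)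
    (card_K : #|K| = q)
    (dim_W : dim_gt W 1)
    (enum_P1 : P1_enum alpha beta)
    (enum_K : bijective gamma)
    (U_sub : forall i, is_subspace (U i) /\ fin_dim (U i))
    (V_sub : forall i, is_subspace (V i) /\ fin_dim (V i))
    (UV_sol : isometry_eq U V)
    (UV_nontriv : ~ tuple_equiv U V) :
  exists U' V' : 'I_q.+1 -> set W,
    pair_equiv U V U' V' /\
    (typeA alpha beta U' V' \/ typeB gamma U' V' \/ typeC alpha beta U' V').
Proof.
subst q.
(* Both tuples form one family, so that one coordinate space serves all their members. *)
pose A (x : 'I_#|K|.+1 + 'I_#|K|.+1) := match x with inl i => U i | inr i => V i end.
have [|n [s sA]] := @finite_fin_dim_cover _ _ _ A.
  by case=> i; [case: (U_sub i)|case: (V_sub i)].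
have [m [f [finj fs]]] := lincomb_injective s.
(* Members lie in the image of [f], so each is the image of its preimage, a subspace of the
   coordinate space. *)
have lift_set (T : 'I_#|K|.+1 -> set W) :
    (forall i, is_subspace (T i)) -> (forall i w, T i w -> exists v, lincomb s v = w) ->
    exists T' : 'I_#|K|.+1 -> {vspace 'rV[K]_m}, T = im f \o T'.
  move=> Tsub Tim.
  have /choice[T' T'E] : forall i, exists X : {vspace 'rV[K]_m}, f @^-1` (T i) = [set` X].
    move=> i; apply: vspace_of_set; have /is_subspaceP[T0 TD] := Tsub i.
    apply/is_subspaceP; split=> [|k u v Tu Tv]; first by rewrite /= linear0.
    by rewrite /= linearP; apply: TD.
  exists T'; apply/funext => i; rewrite /= /im -T'E.
  apply/seteqP; split=> [w Tw|_ [v Tv <-]] //.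
  have [v vw] := Tim i w Tw; have [u uv] := fs v.
  by exists u; rewrite /= uv vw.
have [|i w|U' UE] := lift_set U; first by move=> i; case: (U_sub i).
  exact: (sA (inl i)).
have [|i w|V' VE] := lift_set V; first by move=> i; case: (V_sub i).
  exact: (sA (inr i)).
subst U V; apply: (weighted_eq_classified finj enum_P1 enum_K).
  move=> w; have := congr1 (fun g => g (f w)) UV_sol.
  have E (T : 'I_#|K|.+1 -> {vspace 'rV[K]_m}) :
      \sum_i (card_set ((im f \o T) i))%:R^-1 * \1_((im f \o T) i) (f w) =
      \sum_i (#|K| ^ \dim (T i))%:R^-1 * (w \in T i)%:R :> rat.
    apply: eq_bigr => i _; rewrite /= card_im // indicE; congr (_ * _%:R).
    by congr nat_of_bool; apply/idP/idP; rewrite in_setE => /(im_memE finj).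
  by rewrite /= !E.
by move=> /(tuple_equiv_comp (im f)).
Qed.
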